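(* Let $F$ be an infinite field of characteristic $p>0$, and let $q\in\Lambda(n)$ with $(q,p)=1$ and $\lambda=\lambda(q)\in\Lambda^+_p(n)$. Then there are isomorphisms of right $FS_n$-modules \[\Xi^qe_{\lambda,F}FS_n\cong\mathrm{Lie}_F(q)\cong e_{\lambda,F}FS_n.\] In particular, $\Xi^qe_{\lambda,F}FS_n$ is a projective direct summand of $\Xi^qFS_n$ of dimension $|\mathcal{C}_{\lambda,p}|=|\mathcal{C}_\lambda|=n!/\lambda?$.
   Context: Compositions $q=(q_1,\dots,q_k)$ of $n$; $q^+_j=q_1+\dots+q_j$; $m_i(q)$ number of parts equal to $i$; $(q,p)=1$: no part divisible by $p$; $\lambda(q)$ rearrangement into a partition; $\Lambda^+_p(n)$ partitions with all $m_i<p$; $\lambda?=\prod i^{m_i}m_i!$; $[\lambda]!=\prod m_i(\lambda)!$; $q\approx r$ rearrangement; $r\preccurlyeq q$: a rearrangement of $r$ is a concatenation of compositions of $q_1,\dots,q_k$; $r\prec q$: $r\preccurlyeq q$, $r\not\approx q$. Permutations compose left to right. $\Xi^q$ = sum of $\sigma\in S_n$ with descents in $\{q^+_1,\dots,q^+_k\}$, $\mathcal{D}_n(F)$ their span. $\omega_j=(1-c_j)\cdots(1-c_2)$, $c_i=(i,\dots,1)$; $\omega^q=\omega_{q_1}^{+q^+_0}\cdots\omega_{q_k}^{+q^+_{k-1}}$ ($\sigma^{+r}$ shifts support by $r$); $\omega_q=\omega^q\Xi^q$; $\mathrm{Lie}_F(q)=\omega_qFS_n$. $\mathcal{C}_\lambda$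 is the conjugacy class of cycle type $\lambda$; $\mathcal{C}_{\lambda,p}$ the set of permutations whose cycle type is $p$-equivalent to $\lambda$ ($p'$-parts conjugate). $\{e_{\lambda,F}\}_{\lambda\in\Lambda^+_p(n)}$ is a complete set of orthogonal primitive idempotents of $\mathcal{D}_n(F)$ with sum $1$, such that the Solomon epimorphism ($\Xi^q\mapsto$ permutation character on cosets of $S_q$) sends $e_{\lambda,F}$ to the characteristic function of $\mathcal{C}_{\lambda,p}$, and $e_{\lambda,F}=\frac1{[\lambda]!}\Xi^\lambda+\epsilon_\lambda$ with $\epsilon_\lambda$ a combination of $\Xi^\xi$, $\xi\prec\lambda$. *)

(* Defs.v *)
From HB Require Import structures.
From mathcomp Require Import all_boot all_order all_algebra all_fingroup all_solvable.
Set Implicit Arguments. Unset Strict Implicit. Unset Printing Implicit Defensive.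
Import GRing.Theory.
Local Open Scope ring_scope.

(* The group algebra F S_n, realised as F-valued functions on 'S_n
   (F^o is F viewed as a vector space over itself, so that GA is a vectType). *)
Definition GA (F : fieldType) (n : nat) := {ffun 'S_n -> F^o}.

Section GroupAlgebra.
Variables (F : fieldType) (n : nat).
Local Notation GA := (GA F n).

Definition delta (g : 'S_n) : GA := [ffun h => (h == g)%:R].
(* product; permutations compose left to right, as mathcomp's mulg:
   (s * t) x = t (s x); delta s * delta t = delta (s * t) *)
Definition gmul (a b : GA) : GA :=
  [ffun g => \sum_(h : 'S_n) a h * b (h^-1 * g)%g].
Definition gone : GA := delta 1%g.

Definition rideal (x : GA) : {vspace GA} :=
  <<[seq gmul x (delta g) | g <- enum 'S_n]>>%VS.

Definition rstable (M : {vspace GA}) : Prop :=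
  forall u a, u \in M -> gmul u a \in M.

Definition rmod_iso (M N : {vspace GA}) : Prop :=
  exists f : GA -> GA,
    [/\ forall u, u \in M -> f u \in N,
        forall v, v \in N -> exists2 u, u \in M & f u = v,
        forall u v, u \in M -> v \in M -> f u = f v -> u = v,
        forall (c : F) u v, u \in M -> v \in M -> f (c *: u + v) = c *: f u + f v
      & forall u a, u \in M -> f (gmul u a) = gmul (f u) a].

Definition direct_summand (M N : {vspace GA}) : Prop :=
  exists N' : {vspace GA},
    [/\ rstable N', (M + N')%VS = N & (M :&: N')%VS = 0%VS].

Definition fmul (m : nat) (u : {ffun 'I_m -> GA}) (a : GA) : {ffun 'I_m -> GA} :=
  [ffun i => gmul (u i) a].

(* M is projective: a retract (equivalently a direct summand) of a free
   module (F S_n)^m of finite rank *)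
Definition projective (M : {vspace GA}) : Prop :=
  rstable M /\
  exists (m : nat) (pi : {ffun 'I_m -> GA} -> GA) (sec : GA -> {ffun 'I_m -> GA}),
    [/\ forall w, pi w \in M,
        forall (c : F) w1 w2, pi (c *: w1 + w2) = c *: pi w1 + pi w2,
        forall w a, pi (fmul w a) = gmul (pi w) a,
        forall (c : F) u v, u \in M -> v \in M -> sec (c *: u + v) = c *: sec u + sec v
      & forall u a, u \in M -> sec (gmul u a) = fmul (sec u) a]
    /\ (forall u, u \in M -> pi (sec u) = u).

Definition is_comp (q : seq nat) : bool := all (fun i => 0 < i)%N q && (sumn q == n).
Definition is_part (l : seq nat) : bool := is_comp l && sorted geq l.
Definition is_part_p (p : nat) (l : seq nat) : bool :=
  is_part l && all (fun i => count_mem i l < p)%N l.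
Definition psums (q : seq nat) : seq nat := [seq sumn (take k q) | k <- iota 1 (size q)].

(* descent at (1-based) position i : i sigma > (i+1) sigma *)
Definition descent (s : 'S_n) (i : nat) : bool :=
  [exists j1 : 'I_n, exists j2 : 'I_n,
     [&& (j1.+1 == i)%N, (val j2 == i) & (s j2 < s j1)%N]].

Definition Xi (q : seq nat) : GA :=
  \sum_(s : 'S_n | [forall j : 'I_n, descent s j ==> (nat_of_ord j \in psums q)]) delta s.

Definition inD (x : GA) : Prop :=
  exists cs : seq (F * seq nat),
    all (fun c => is_comp c.2) cs /\ x = \sum_(c <- cs) c.1 *: Xi c.2.

Definition comp_le (r q : seq nat) : Prop :=
  exists rs : seq (seq nat),
    [/\ size rs = size q,
        forall j, (j < size q)%N ->
          all (fun i => 0 < i)%N (nth [::] rs j) /\ sumn (nth [::] rs j) = nth 0%N q j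
      & perm_eq r (flatten rs)].
Definition comp_lt (r q : seq nat) : Prop := comp_le r q /\ ~~ perm_eq r q.

Definition cycletype (s : 'S_n) : seq nat := sort geq (map (fun X : {set 'I_n} => #|X|) (enum (porbits s))).
Definition cclass (l : seq nat) : {set 'S_n} := [set s | cycletype s == l].
Definition cclass_p (p : nat) (l : seq nat) : {set 'S_n} :=
  [set s | [exists t : 'S_n, (cycletype t == l) &&
             (s.`_(p^') \in (t.`_(p^')) ^: [set: 'S_n])]%g].

(* value at s of the permutation character of S_n on the cosets of the Young
   subgroup S_xi: the number of s-invariant set compositions of type xi *)
Definition permchar (xi : seq nat) (s : 'S_n) : nat :=
  #|[set f : {ffun 'I_n -> 'I_(size xi)} |
      [forall j, #|[set x | f x == j]| == nth 0%N xi j] && [forall x, f (s x) == f x]]|.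

Definition mfact (l : seq nat) : nat := \prod_(i <- undup l) (count_mem i l)`!.
Definition zq (l : seq nat) : nat :=
  \prod_(i <- undup l) (i ^ (count_mem i l) * (count_mem i l)`!).

Definition tp (a b : nat) : 'S_n :=
  match insub a, insub b with Some x, Some y => tperm x y | _, _ => 1%g end.
(* c_i^{+r} = (r+i, ..., r+1) (1-based), i.e. r+j |-> r+j-1, r+1 |-> r+i *)
Definition cyc (r i : nat) : 'S_n := (\prod_(j < i.-1) tp (r + j) (r + j).+1)%g.
Definition omega_sh (r j : nat) : GA :=
  foldr (fun i acc => gmul (gone - delta (cyc r i)) acc) gone (rev (iota 2 j.-1)).
Definition omega_up (q : seq nat) : GA :=
  foldr (fun j acc => gmul (omega_sh (sumn (take j q)) (nth 0%N q j)) acc) gone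
        (iota 0 (size q)).
Definition omega_q (q : seq nat) : GA := gmul (omega_up q) (Xi q).
Definition Lie (q : seq nat) : {vspace GA} := rideal (omega_q q).

Definition idem_family (p : nat) (e : seq nat -> GA) : Prop :=
  [/\ forall l, is_part_p p l -> inD (e l),
      forall l, is_part_p p l -> gmul (e l) (e l) = e l,
      forall l m, is_part_p p l -> is_part_p p m -> l != m -> gmul (e l) (e m) = 0,
      forall l, is_part_p p l -> e l != 0 /\
        (forall a b, inD a -> inD b -> gmul a a = a -> gmul b b = b ->
           gmul a b = 0 -> gmul b a = 0 -> a + b = e l -> a = 0 \/ b = 0)
    &
      exists2 L : seq (seq nat), uniq L /\ (forall l, (l \in L) = is_part_p p l) &
        \sum_(l <- L) e l = gone]
  /\
  ((* the Solomon epimorphism sends e_l to the indicator of C_{l,p} *)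
   (forall l, is_part_p p l -> exists cs : seq (F * seq nat),
      [/\ all (fun c => is_comp c.2) cs, e l = \sum_(c <- cs) c.1 *: Xi c.2
        & forall s, \sum_(c <- cs) c.1 * (permchar c.2 s)%:R = (s \in cclass_p p l)%:R])
   /\
   (forall l, is_part_p p l -> exists cs : seq (F * seq nat),
      (forall c, c \in cs -> is_comp c.2 /\ comp_lt c.2 l) /\
      e l = ((mfact l)%:R)^-1 *: Xi l + \sum_(c <- cs) c.1 *: Xi c.2)).

End GroupAlgebra.

(* Main.v *)
Require Import Defs.
From HB Require Import structures.
From mathcomp Require Import all_boot all_order all_algebra all_fingroup all_solvable.
From mathcomp Require Import zify.
Set Implicit Arguments. Unset Strict Implicit. Unset Printing Implicit Defensive.
Import GRing.Theory Num.Theory VectorInternalTheory.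
Local Open Scope ring_scope.

(** A permutation s is read as the word (s 0) ... (s (n-1)), on which F S_n acts from the
    left by place permutations.  Then Xi^q deconcatenates a word into subwords of lengths
    q_1, ..., q_k in all possible ways and concatenates the results, and omega_q moreover
    brackets each subword.  Brackets being primitive for the unshuffle coproduct,
    Xi^r omega_q vanishes when r has more parts than q, and is [lambda]! omega_r when r is a
    rearrangement of q.  Newton's identity gives omega_q = (prod q_i) Xi^q + (terms Xi^r with
    more parts), so omega_r omega_q = lambda? omega_r for rearrangements; by hypothesis
    lambda? is invertible in F, hence f_q = omega_q / lambda? is an idempotent of D_n.

    The triangular form of e_lambda gives e_lambda f_lambda = f_lambda, so f_lambda e_lambda
    is a nonzero idempotent of e_lambda D_n e_lambda (D_n is a ring, by a Mackey formula),
    and primitivity forces f_lambda e_lambda = e_lambda.  Therefore e_lambda F S_n =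
    Lie(lambda), Xi^q e_lambda F S_n = Lie(q) = f_q F S_n, and left multiplication by
    f_lambda and f_q are inverse isomorphisms between Lie(q) and Lie(lambda).

    The dimension is the rank of the integral matrix W of left multiplication by omega_q,
    where W^2 = lambda? W.  Ranks of W and lambda? - W can only drop modulo p, and they add
    up to n! both over Q and over F, so the rank over F is tr W / lambda? = n! / lambda?.
    On the other side lambda? is the order of the centralizer of a permutation of cycle type
    lambda; it is prime to p, so that C_{lambda,p} = C_lambda. *)

(** * Words, unshuffles and Lie brackets *)

(** The unshuffle coproduct of a word: every subword, taken by positions, with its complementary
    subword. *)
Fixpoint splits (T : Type) (w : seq T) : seq (seq T * seq T) :=
  if w is a :: w' then
    [seq (a :: x.1, x.2) | x <- splits w'] ++ [seq (x.1, a :: x.2) | x <- splits w']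
  else [:: ([::], [::])].

(** The iterated coproduct in multidegree [q]. Blocks are kept apart so that each can be bracketed
    later; the list is empty unless the lengths in [q] add up to that of [w]. *)
Fixpoint unsh (T : Type) (q : seq nat) (w : seq T) : seq (seq (seq T)) :=
  if q is a :: q' then
    [seq x.1 :: us | x <- [seq x <- splits w | size x.1 == a], us <- unsh q' x.2]
  else if w is [::] then [:: [::]] else [::].

Section Splits.
Variables (T : Type) (V : zmodType).
Implicit Types (w u v : seq T).

(** Coproduct identities are stated as equalities of sums of an arbitrary [f] with values in an
    abelian group, so that the order of the lists is irrelevant. *)
Lemma big_splits_cons a w (f : seq T -> seq T -> V) :
  \sum_(x <- splits (a :: w)) f x.1 x.2 =
  \sum_(x <- splits w) f (a :: x.1) x.2 + \sum_(x <- splits w) f x.1 (a :: x.2).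
Proof. by rewrite /= big_cat !big_map. Qed.

Lemma big_splits0 (f : seq T -> seq T -> V) :
  \sum_(x <- splits [::]) f x.1 x.2 = f [::] [::].
Proof. by rewrite big_seq1. Qed.

Lemma big_splits_cat u v (f : seq T -> seq T -> V) :
  \sum_(x <- splits (u ++ v)) f x.1 x.2 =
  \sum_(x <- splits u) \sum_(y <- splits v) f (x.1 ++ y.1) (x.2 ++ y.2).
Proof.
elim: u f => [|a u IH] f; first by rewrite big_seq1.
rewrite cat_cons big_splits_cons (IH (fun x y => f (a :: x) y)) (IH (fun x y => f x (a :: y))).
by rewrite (big_splits_cons a u (fun x y => \sum_(z <- splits v) f (x ++ z.1) (y ++ z.2))).
Qed.

Lemma big_splits_rcons u a (f : seq T -> seq T -> V) :
  \sum_(x <- splits (rcons u a)) f x.1 x.2 =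
  \sum_(x <- splits u) (f (rcons x.1 a) x.2 + f x.1 (rcons x.2 a)).
Proof.
rewrite -cats1 big_splits_cat; apply: eq_bigr => x _.
rewrite (big_splits_cons a [::] (fun s t => f (x.1 ++ s) (x.2 ++ t))).
by rewrite (big_splits0 (fun s t => f (x.1 ++ a :: s) (x.2 ++ t)))
  (big_splits0 (fun s t => f (x.1 ++ s) (x.2 ++ a :: t))) !cats1 !cats0.
Qed.

(** Coassociativity: both sides send each letter to one of three classes. *)
Lemma big_splits_coassoc w (f : seq T -> seq T -> seq T -> V) :
  \sum_(x <- splits w) \sum_(y <- splits x.2) f x.1 y.1 y.2 =
  \sum_(x <- splits w) \sum_(y <- splits x.1) f y.1 y.2 x.2.
Proof.
elim: w f => [|a w IH] f; first by rewrite !big_seq1.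
rewrite (big_splits_cons a w (fun s t => \sum_(y <- splits t) f s y.1 y.2)).
rewrite (big_splits_cons a w (fun s t => \sum_(y <- splits s) f y.1 y.2 t)).
under [X in _ + X = _]eq_bigr => x _ do rewrite (big_splits_cons a x.2 (fun s t => f x.1 s t)).
under [X in _ = X + _]eq_bigr => x _ do rewrite (big_splits_cons a x.1 (fun s t => f s t x.2)).
rewrite !big_split /= (IH (fun s t r => f (a :: s) t r)) (IH (fun s t r => f s (a :: t) r)).
by rewrite (IH (fun s t r => f s t (a :: r))) !addrA.
Qed.

(** Cocommutativity on two of three factors: the induction merely permutes the three terms that
    place the first letter. *)
Lemma big_splits_exch3 w (f : seq T -> seq T -> seq T -> V) :
  \sum_(x <- splits w) \sum_(y <- splits x.2) f x.1 y.1 y.2 =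
  \sum_(x <- splits w) \sum_(y <- splits x.2) f y.1 x.1 y.2.
Proof.
elim: w f => [|a w IH] f; first by rewrite !big_seq1.
rewrite (big_splits_cons a w (fun s t => \sum_(y <- splits t) f s y.1 y.2)).
rewrite (big_splits_cons a w (fun s t => \sum_(y <- splits t) f y.1 s y.2)).
under [X in _ + X = _]eq_bigr => x _ do rewrite (big_splits_cons a x.2 (fun s t => f x.1 s t)).
under [X in _ = _ + X]eq_bigr => x _ do rewrite (big_splits_cons a x.2 (fun s t => f s x.1 t)).
rewrite !big_split /= (IH (fun s t r => f (a :: s) t r)) (IH (fun s t r => f s (a :: t) r)).
by rewrite (IH (fun s t r => f s t (a :: r))) !addrA; congr (_ + _); rewrite addrC.
Qed.

Lemma big_splits_exch4 w (f : seq T -> seq T -> seq T -> seq T -> V) :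
  \sum_(x <- splits w) \sum_(y <- splits x.1) \sum_(z <- splits x.2) f y.1 y.2 z.1 z.2 =
  \sum_(x <- splits w) \sum_(y <- splits x.1) \sum_(z <- splits x.2) f y.1 z.1 y.2 z.2.
Proof.
rewrite -(big_splits_coassoc w (fun s t r => \sum_(z <- splits r) f s t z.1 z.2)).
rewrite -(big_splits_coassoc w (fun s t r => \sum_(z <- splits r) f s z.1 t z.2)).
apply: eq_bigr => x _.
exact: (big_splits_exch3 x.2 (fun s t r => f x.1 s t r)).
Qed.

Lemma big_splits_size0 w (f : seq T -> seq T -> V) :
  \sum_(x <- splits w | size x.1 == 0%N) f x.1 x.2 = f [::] w.
Proof.
elim: w f => [|a w IH] f; first by rewrite /= big_mkcond big_seq1.
by rewrite /= big_cat !big_map /= big_pred0_eq add0r (IH (fun s t => f s (a :: t))).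
Qed.

Lemma big_unsh0 w (f : seq (seq T) -> V) :
  \sum_(us <- unsh [::] w) f us = if w is [::] then f [::] else 0.
Proof. by case: w => [|a w] /=; rewrite ?big_seq1 ?big_nil. Qed.

Lemma big_unsh_cons a q w (f : seq (seq T) -> V) :
  \sum_(us <- unsh (a :: q) w) f us =
  \sum_(x <- splits w | size x.1 == a) \sum_(us <- unsh q x.2) f (x.1 :: us).
Proof. by rewrite /= big_allpairs_dep big_filter. Qed.

Lemma big_unsh_zero q w (f : seq (seq T) -> V) :
  \sum_(us <- unsh (0%N :: q) w) f us = \sum_(us <- unsh q w) f ([::] :: us).
Proof.
rewrite big_unsh_cons.
exact: (big_splits_size0 w (fun s t => \sum_(us <- unsh q t) f (s :: us))).
Qed.

End Splits.

Lemma splits_map (T U : Type) (h : T -> U) w :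
  splits (map h w) = [seq (map h x.1, map h x.2) | x <- splits w].
Proof. by elim: w => //= a w ->; rewrite map_cat -!map_comp. Qed.

Lemma unsh_map (T U : Type) (h : T -> U) q w :
  unsh q (map h w) = map (map (map h)) (unsh q w).
Proof.
elim: q w => [|a q IH] w; first by case: w.
rewrite /= splits_map filter_map map_allpairs allpairs_mapl /=.
rewrite (@eq_filter _ _ (fun x => size x.1 == a)); last by move=> x /=; rewrite size_map.
congr flatten; apply: eq_map => x /=.
by rewrite IH -map_comp.
Qed.

Section Support.
Variable T : eqType.
Implicit Types (w u v : seq T).

Lemma splits_perm w (x : seq T * seq T) : x \in splits w -> perm_eq (x.1 ++ x.2) w.
Proof.
elim: w x => [|a w IH] x; first by rewrite inE => /eqP ->.
rewrite mem_cat => /orP[] /mapP[y /IH yw ->] /=; first by rewrite perm_cons.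
by rewrite -cat1s perm_catCA /= perm_cons.
Qed.

Lemma splits_size w (x : seq T * seq T) : x \in splits w -> (size x.1 + size x.2)%N = size w.
Proof. by move/splits_perm/perm_size; rewrite size_cat. Qed.

Lemma unsh_shape q w us : us \in unsh q w -> shape us = q.
Proof.
elim: q w us => [|a q IH] w us; first by case: w => //; rewrite inE => /eqP ->.
move/allpairsPdep => -[x [vs [xs /IH vsq ->]]] /=.
by move: xs; rewrite mem_filter vsq => /andP[/eqP ->].
Qed.

Lemma unsh_perm q w us : us \in unsh q w -> perm_eq (flatten us) w.
Proof.
elim: q w us => [|a q IH] w us; first by case: w => //; rewrite inE => /eqP ->.
move/allpairsPdep => -[x [vs [xs /IH vsq ->]]] /=.
move: xs; rewrite mem_filter => /andP[_ /splits_perm xw].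
by apply: perm_trans xw; rewrite perm_cat2l.
Qed.

Lemma unsh_sumn q w us : us \in unsh q w -> sumn q = size w.
Proof. by move=> h; rewrite -(unsh_shape h) -size_flatten (perm_size (unsh_perm h)). Qed.

End Support.

Section UnshCat.
Variables (T : eqType) (V : zmodType).
Implicit Types (w u v : seq T).

(** By coassociativity, cutting off the blocks of [r] one at a time amounts to cutting off their
    union first. *)
Lemma big_unsh_cat r s w (f : seq (seq T) -> V) :
  \sum_(us <- unsh (r ++ s) w) f us =
  \sum_(x <- splits w) \sum_(us <- unsh r x.1) \sum_(vs <- unsh s x.2) f (us ++ vs).
Proof.
elim: r w f => [|a r IH] w f.
  rewrite -(big_splits_size0 w (fun _ t => \sum_(us <- unsh s t) f us)) big_mkcond.
  by apply: eq_bigr => x _; rewrite big_unsh0; case: x.1.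
rewrite cat_cons big_unsh_cons.
under eq_bigr => x _ do rewrite IH.
under [RHS]eq_bigr => x _ do rewrite big_unsh_cons big_mkcond.
rewrite big_mkcond -(big_splits_coassoc w (fun s' t' r' => if size s' == a then
  \sum_(us <- unsh r t') \sum_(vs <- unsh s r') f ((s' :: us) ++ vs) else 0)).
by apply: eq_bigr => x _; case: ifP => _ //; rewrite big1.
Qed.

End UnshCat.

Section Lie.
Variables (T : eqType).
Implicit Types (w u v : seq T).

(* The left-normed bracket [..[[a1,a2],a3],..,ak] as a list of signed words. *)
Definition brk (L : seq (int * seq T)) (b : T) :=
  [seq (c.1, rcons c.2 b) | c <- L] ++ [seq (- c.1, b :: c.2) | c <- L].
Definition lie w : seq (int * seq T) :=
  if w is a :: w' then foldl brk [:: (1, [:: a])] w' else [::].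
Definition lies (us : seq (seq T)) : seq (int * seq T) :=
  foldr (fun u L => [seq (c.1 * d.1, c.2 ++ d.2) | c <- lie u, d <- L]) [:: (1, [::])] us.

Lemma lie_rcons w a : w != [::] -> lie (rcons w a) = brk (lie w) a.
Proof. by case: w => // b w _; rewrite /= -cats1 foldl_cat. Qed.

Lemma lie_perm w c : c \in lie w -> perm_eq c.2 w.
Proof.
elim/last_ind: w c => [|w a IH] // c.
have [->|w0] := eqVneq w [::]; first by rewrite inE => /eqP ->.
rewrite lie_rcons // mem_cat => /orP[] /mapP[d /IH dw ->] /=.
  by rewrite -!cats1 perm_cat2r.
by rewrite perm_sym perm_rcons perm_cons perm_sym.
Qed.

Lemma lies_perm us c : c \in lies us -> perm_eq c.2 (flatten us).
Proof.
elim: us c => [|u us IH] c; first by rewrite inE => /eqP ->.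
move/allpairsPdep => -[x [y [/lie_perm xu /IH yus ->]]] /=.
exact: perm_cat.
Qed.

Section Eval.
Variable V : zmodType.

(** The linear extension of [f], applied to the noncommutative polynomial that [L] represents.
    Integer coefficients keep the brackets independent of the field. *)
Definition ev (L : seq (int * seq T)) (f : seq T -> V) : V := \sum_(c <- L) f c.2 *~ c.1.

Lemma eq_ev_seq L f g : (forall c, c \in L -> f c.2 = g c.2) -> ev L f = ev L g.
Proof. by move=> h; apply: eq_big_seq => c /h ->. Qed.

Lemma eq_ev L f g : f =1 g -> ev L f = ev L g.
Proof. by move=> h; apply: eq_ev_seq => c _; apply: h. Qed.

Lemma ev_sum (I : Type) (r : seq I) L f :
  ev L (fun w => \sum_(i <- r) f i w) = \sum_(i <- r) ev L (f i).
Proof. by rewrite exchange_big; apply: eq_bigr => c _; rewrite mulrz_suml. Qed.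

Lemma evD L f g : ev L (fun w => f w + g w) = ev L f + ev L g.
Proof. by rewrite -big_split; apply: eq_bigr => c _; rewrite mulrzDl. Qed.

Lemma evN L f : ev L (fun w => - f w) = - ev L f.
Proof. by rewrite -sumrN; apply: eq_bigr => c _; rewrite mulNrz. Qed.

Lemma ev0 L : ev L (fun=> 0) = 0.
Proof. by apply: big1 => c _; rewrite mul0rz. Qed.

Lemma ev_if L (b : bool) f : ev L (fun w => if b then f w else 0) = if b then ev L f else 0.
Proof. by case: b => //; apply: ev0. Qed.

Lemma ev_exch L K (f : seq T -> seq T -> V) :
  ev L (fun x => ev K (fun y => f x y)) = ev K (fun y => ev L (fun x => f x y)).
Proof.
rewrite /ev; under eq_bigr => c _ do rewrite mulrz_suml.
rewrite exchange_big; apply: eq_bigr => c _; rewrite mulrz_suml.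
by apply: eq_bigr => d _; rewrite mulrzAC.
Qed.

Lemma ev_lie1 a f : ev (lie [:: a]) f = f [:: a].
Proof. by rewrite /ev big_seq1. Qed.

Lemma ev_lie_rcons w a f : w != [::] ->
  ev (lie (rcons w a)) f = ev (lie w) (fun u => f (rcons u a) - f (a :: u)).
Proof.
move=> w0; rewrite lie_rcons // evD evN /ev big_cat !big_map; congr (_ + _).
by rewrite -sumrN; apply: eq_bigr => c _; rewrite mulrNz.
Qed.

Lemma ev_lies0 f : ev (lies [::]) f = f [::].
Proof. by rewrite /ev big_seq1. Qed.

Lemma ev_lies_cons u us f :
  ev (lies (u :: us)) f = ev (lie u) (fun x => ev (lies us) (fun y => f (x ++ y))).
Proof.
rewrite /ev big_allpairs_dep; apply: eq_bigr => c _; rewrite mulrz_suml.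
by apply: eq_bigr => d _ /=; rewrite mulrC mulrzA.
Qed.

Lemma ev_lies_cat us vs f :
  ev (lies (us ++ vs)) f = ev (lies us) (fun x => ev (lies vs) (fun y => f (x ++ y))).
Proof.
elim: us f => [|u us IH] f; first by rewrite ev_lies0.
rewrite cat_cons !ev_lies_cons; apply: eq_ev => x; rewrite IH.
by apply: eq_ev => y; apply: eq_ev => z; rewrite catA.
Qed.

(* Lie polynomials are primitive for the unshuffle coproduct. *)
Lemma ev_lie_splits w (f : seq T -> seq T -> V) :
  ev (lie w) (fun u => \sum_(x <- splits u) f x.1 x.2) =
  ev (lie w) (fun u => f u [::] + f [::] u).
Proof.
elim/last_ind: w f => [|w a IH] f; first by rewrite /ev !big_nil.
have [->|w0] := eqVneq w [::].
  by rewrite !ev_lie1 big_splits_cons /= !big_seq1.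
rewrite !ev_lie_rcons //.
transitivity (ev (lie w) (fun u => \sum_(x <- splits u) ((f (rcons x.1 a) x.2 +
   f x.1 (rcons x.2 a)) - (f (a :: x.1) x.2 + f x.1 (a :: x.2))))).
  apply: eq_ev => u; rewrite big_splits_rcons big_splits_cons -big_split /=.
  by rewrite sumrB.
rewrite (IH (fun s t => (f (rcons s a) t +
   f s (rcons t a)) - (f (a :: s) t + f s (a :: t)))).
apply: eq_ev => u /=.
(* Next to an empty factor, appending [a] and prepending [a] give the same word, so the terms where
   [a] forms a factor alone cancel. *)
rewrite [X in X + _ = _](_ : _ = f (rcons u a) [::] - f (a :: u) [::]); last first.
  by rewrite opprD addrACA subrr addr0.
rewrite [X in _ + X = _](_ : _ = f [::] (rcons u a) - f [::] (a :: u)); last first.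
  by rewrite opprD addrACA subrr add0r.
by rewrite addrACA opprD.
Qed.

(** A primitive bracket passes entire into one of the two factors, and the coproduct is
    multiplicative for concatenation. *)
Lemma ev_lies_splits us (f : seq T -> seq T -> V) :
  ev (lies us) (fun w => \sum_(x <- splits w) f x.1 x.2) =
  \sum_(X <- splits us) ev (lies X.1) (fun a => ev (lies X.2) (fun b => f a b)).
Proof.
elim: us f => [|u us IH] f; first by rewrite big_seq1 !ev_lies0 big_seq1.
rewrite ev_lies_cons.
pose G s t := ev (lies us) (fun y => \sum_(r <- splits y) f (s ++ r.1) (t ++ r.2)).
transitivity (ev (lie u) (fun x => \sum_(s <- splits x) G s.1 s.2)).
  apply: eq_ev => x; rewrite -ev_sum; apply: eq_ev => y.
  by rewrite big_splits_cat.
rewrite ev_lie_splits evD /G.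
rewrite (big_splits_cons u us (fun s t => ev (lies s) (fun a => ev (lies t) (fun b => f a b)))).
congr (_ + _).
- under [RHS]eq_bigr => X _ do rewrite ev_lies_cons.
  rewrite -ev_sum; apply: eq_ev => x.
  exact: (IH (fun s t => f (x ++ s) t)).
- transitivity (\sum_(X <- splits us) ev (lie u) (fun x => ev (lies X.1) (fun a => ev (lies X.2)
    (fun b => f a (x ++ b))))).
    by rewrite -ev_sum; apply: eq_ev => x; exact: (IH (fun s t => f s (x ++ t))).
  apply: eq_bigr => X _; rewrite ev_exch; apply: eq_ev => a.
  by rewrite ev_lies_cons.
Qed.

End Eval.
End Lie.

(** * Products of Xi^r with brackets *)

(* The ways to distribute the blocks us, in order, over groups of total sizes r. *)
Fixpoint grp (T : Type) (r : seq nat) (us : seq (seq T)) : seq (seq (seq T)) :=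
  if r is a :: r' then
    [seq X.1 ++ g | X <- [seq X <- splits us | sumn (shape X.1) == a], g <- grp r' X.2]
  else if us is [::] then [:: [::]] else [::].

(** The splittings of [s] with exactly one entry on the left, that entry being unwrapped. *)
Fixpoint picks (T : Type) (s : seq T) : seq (T * seq T) :=
  if s is a :: s' then (a, s') :: [seq (p.1, a :: p.2) | p <- picks s'] else [::].

Section Groupings.
Variables (T : eqType) (V : zmodType).
Implicit Types (w : seq T) (us : seq (seq T)).

Lemma big_grp_cons a r us (f : seq (seq T) -> V) :
  \sum_(g <- grp (a :: r) us) f g =
  \sum_(X <- splits us | sumn (shape X.1) == a) \sum_(g <- grp r X.2) f (X.1 ++ g).
Proof. by rewrite /= big_allpairs_dep big_filter. Qed.

Lemma lies_size us c : c \in lies us -> size c.2 = sumn (shape us).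
Proof. by move/lies_perm/perm_size; rewrite size_flatten. Qed.

(** Describes Xi^r on a product of brackets: by [ev_lies_splits] no bracket is ever cut, so whole
    blocks are distributed over the parts of [r]. *)
Lemma ev_lies_unsh r us (f : seq T -> V) :
  ev (lies us) (fun w => \sum_(vs <- unsh r w) f (flatten vs)) =
  \sum_(g <- grp r us) ev (lies g) f.
Proof.
elim: r us f => [|a r IH] us f.
  case: us => [|u us]; first by rewrite !ev_lies0 big_unsh0 /= big_seq1 ev_lies0.
  (* No word of a non-empty product of brackets is empty: the bracket of an empty block is 0, and
     any other bracket preserves length. *)
  rewrite /= big_nil -[RHS](ev0 _ (lies (u :: us))); apply: eq_ev_seq => c cL.
  rewrite big_unsh0; case: c cL => c [|b v] //.
  move/allpairsPdep => -[x [y [xu _ [_]]]] /esym/eqP.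
  case: u xu => // b u /lie_perm/perm_size; by case: x => x [].
rewrite big_grp_cons.
under eq_ev => w do rewrite big_unsh_cons big_mkcond.
rewrite (ev_lies_splits us (fun s t => if size s == a then \sum_(vs <- unsh r t)
  f (flatten (s :: vs)) else 0)) [RHS]big_mkcond.
apply: eq_bigr => X _.
rewrite (@eq_ev_seq _ _ _ _ (fun s => if sumn (shape X.1) == a then
   ev (lies X.2) (fun t => \sum_(vs <- unsh r t) f (s ++ flatten vs)) else 0)); last first.
  by move=> c /lies_size ->; rewrite ev_if.
rewrite ev_if; case: ifP => // _.
under eq_ev => s do rewrite (IH X.2 (fun t => f (s ++ t))).
by rewrite ev_sum; apply: eq_bigr => g _; rewrite ev_lies_cat.
Qed.

(** A group of positive total size uses at least one block. *)
Lemma grp_nil r us : all (leq 1) r -> (size us < size r)%N -> grp r us = [::].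
Proof.
elim: r us => [|a r IH] us //= /andP[a0 r0] szr.
apply/eqP; rewrite -size_eq0; apply/eqP; rewrite size_allpairs_dep sumnE big_map big_filter.
rewrite big_seq_cond big1 // => X /andP[/splits_size Xus /eqP Xa].
rewrite IH //; case: (X.1) Xus Xa => [|x X1] /=; lia.
Qed.

Lemma picks_perm (s : seq nat) p : p \in picks s -> perm_eq (p.1 :: p.2) s.
Proof.
elim: s p => [|a s IH] p //=; rewrite inE => /orP[/eqP -> //|/mapP[x /IH xs ->]] /=.
by rewrite -cat1s -[_ :: x.2]cat1s perm_catCA /= perm_cons.
Qed.

Lemma count_picks a (s : seq nat) : count (fun p => p.1 == a) (picks s) = count_mem a s.
Proof. by elim: s => //= b s IH; rewrite count_map IH. Qed.

Lemma big_splits_size1 us (f : seq (seq T) -> seq (seq T) -> V) :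
  \sum_(X <- splits us | size X.1 == 1%N) f X.1 X.2 = \sum_(p <- picks us) f [:: p.1] p.2.
Proof.
elim: us f => [|u us IH] f; first by rewrite /= big_mkcond big_seq1 big_nil.
rewrite /= big_cat !big_map /= big_cons big_map; congr (_ + _).
  under eq_bigl => X do rewrite eqSS.
  exact: (big_splits_size0 us (fun s t => f (u :: s) t)).
exact: (IH (fun s t => f s (u :: t))).
Qed.

(** Singling out a block after unshuffling is the same as cutting it off first; [big_splits_exch3]
    moves it past the blocks in front of it. *)
Lemma big_unsh_picks q w (f : seq T -> seq (seq T) -> V) :
  \sum_(us <- unsh q w) \sum_(p <- picks us) f p.1 p.2 =
  \sum_(p <- picks q) \sum_(x <- splits w | size x.1 == p.1)
    \sum_(us <- unsh p.2 x.2) f x.1 us.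
Proof.
elim: q w f => [|a q IH] w f; first by rewrite big_unsh0; case: w => [|? ?]; rewrite !big_nil.
rewrite big_unsh_cons /= big_cons big_map /=.
under eq_bigr => x _ do under eq_bigr => us _ do rewrite /= big_cons big_map /=.
under eq_bigr => x _ do rewrite big_split /=.
rewrite big_split /=; congr (_ + _).
under eq_bigr => x _ do rewrite (IH x.2 (fun s t => f s (x.1 :: t))).
rewrite exchange_big; apply: eq_bigr => p _ /=.
under [RHS]eq_bigr => x _ do rewrite big_unsh_cons.
rewrite big_mkcond [RHS]big_mkcond /=.
rewrite (eq_bigr (fun x => \sum_(y <- splits x.2) if (size x.1 == a) && (size y.1 == p.1) then
  \sum_(us <- unsh p.2 y.2) f y.1 (x.1 :: us) else 0)); last first.
  move=> x _; case: ifP => _ /=; last by rewrite big1.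
  by rewrite big_mkcond.
rewrite (big_splits_exch3 w (fun s t v => if (size s == a) && (size t == p.1) then
  \sum_(us <- unsh p.2 v) f t (s :: us) else 0)).
apply: eq_bigr => x _; case: ifP => xp; last by apply: big1 => y _; rewrite andbF.
by rewrite [RHS]big_mkcond; apply: eq_bigr => y _; rewrite andbT.
Qed.

Lemma mfact_cons a l : mfact (a :: l) = (count_mem a (a :: l) * mfact l)%N.
Proof.
rewrite /mfact /=; case: ifP => al; last first.
  rewrite big_cons /= eqxx add1n (count_memPn (negbT al)); congr muln.
  rewrite big_seq [RHS]big_seq; apply: eq_bigr => i; rewrite mem_undup => il.
  by case: eqP => // ai; rewrite ai il in al.
rewrite (bigD1_seq a) ?mem_undup ?undup_uniq //= [in RHS](bigD1_seq a) ?mem_undup ?undup_uniq //=.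
rewrite eqxx add1n factS mulnA; congr muln.
by apply: eq_bigr => i /negPf; rewrite eq_sym => ->.
Qed.

(** If the first group took two blocks, too few would remain for the groups of [r], and [grp_nil]
    applies. *)
Lemma grp_big_size1 a r us (f : seq (seq T) -> V) : (0 < a)%N -> all (leq 1) r ->
  (size us <= (size r).+1)%N ->
  \sum_(g <- grp (a :: r) us) f g =
  \sum_(p <- picks us | size p.1 == a) \sum_(g <- grp r p.2) f (p.1 :: g).
Proof.
move=> a0 r0 szus; rewrite big_grp_cons [RHS]big_mkcond.
transitivity (\sum_(X <- splits us | size X.1 == 1%N)
  if sumn (shape X.1) == a then \sum_(g <- grp r X.2) f (X.1 ++ g) else 0); last first.
  rewrite (big_splits_size1 us (fun s t =>
    if sumn (shape s) == a then \sum_(g <- grp r t) f (s ++ g) else 0)).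
  by apply: eq_bigr => p _; rewrite /= addn0.
rewrite big_mkcond [RHS]big_mkcond; apply: eq_big_seq => X /splits_size XS.
case: ifP => [/eqP|]; last by case: ifP.
case: (X.1) XS => [|x X1] /= XS XA; first by lia.
case: ifP => // /negbT; case: X1 {XA} XS => [|y X1] //= XS _.
by rewrite grp_nil ?big_nil //; lia.
Qed.

(** With as many blocks as groups, every group is a single block. A grouping is then a matching of
    equal parts of [q] and [r], and there are [mfact r] of these. *)
Lemma big_unsh_grp r q w (f : seq (seq T) -> V) : all (leq 1) r -> perm_eq r q ->
  \sum_(us <- unsh q w) \sum_(g <- grp r us) f g =
  (\sum_(us <- unsh r w) f us) *+ mfact r.
Proof.
elim: r q w f => [|a r IH] q w f.
  move=> _; rewrite perm_sym => /perm_nilP ->; rewrite /mfact big_nil mulr1n.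
  by rewrite !big_unsh0; case: w => //=; rewrite big_seq1.
case/andP=> a0 r0 rq.
transitivity (\sum_(us <- unsh q w) \sum_(p <- picks us)
  if size p.1 == a then \sum_(g <- grp r p.2) f (p.1 :: g) else 0).
  apply: eq_big_seq => us /unsh_shape usq; rewrite grp_big_size1 // 1?big_mkcond //.
  by rewrite -(size_map size) -/(shape us) usq -(perm_size rq).
rewrite (big_unsh_picks q w (fun s t => if size s == a then \sum_(g <- grp r t) f (s :: g) else 0)).
(* Each choice of a part [a] of [q] contributes the same amount by induction; the number of choices
   is the first factor in [mfact_cons]. *)
transitivity (\sum_(p <- picks q | p.1 == a)
  (\sum_(us <- unsh (a :: r) w) f us) *+ mfact r).
  rewrite [RHS]big_mkcond; apply: eq_big_seq => p /picks_perm pq.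
  case: ifP => [/eqP pa|pa]; last first.
    by apply: big1 => x /eqP xp; rewrite big1 // => us _; rewrite xp pa.
  rewrite big_unsh_cons -sumrMnl pa; apply: eq_bigr => x ->.
  rewrite IH // -(perm_cons a); apply: perm_trans rq _.
  by rewrite perm_sym -pa.
by rewrite big_const_seq count_picks iter_addr_0 -mulrnA mfact_cons mulnC (seq.permP rq).
Qed.

End Groupings.

(** * Newton's identity and the expansion of Dynkin's operator *)

Section Newton.
Variables (T : eqType) (V : zmodType).
Implicit Types (w : seq T).

(** Multiplication by the length is the convolution of the identity with Dynkin's operator. For a
    new last letter [a], the part of the bracket with [a] in front cancels against the splittings
    with [a] on the left; what remains is the induction hypothesis and one extra term, from the
    splitting with empty right half. *)
Lemma newton w (f : seq T -> V) :
  f w *+ size w = \sum_(x <- splits w) ev (lie x.2) (fun v => f (x.1 ++ v)).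
Proof.
elim/last_ind: w f => [|w a IH] f; first by rewrite big_seq1 /ev big_nil.
rewrite (big_splits_rcons w a (fun s t => ev (lie t) (fun v => f (s ++ v)))).
transitivity (\sum_(x <- splits w) (ev (lie x.2) (fun v => f (rcons (x.1 ++ v) a)) +
   if x.2 is [::] then f (rcons x.1 a) else 0)).
  rewrite big_split /= -(IH (fun v => f (rcons v a))) size_rcons mulrSr; congr (_ + _).
  elim: w (f) {IH} => [|b w IH] g; first by rewrite big_seq1.
  rewrite (big_splits_cons b w (fun s t => if t is [::] then g (rcons s a) else 0)) /=.
  by rewrite [X in _ = _ + X]big1 // addr0 -(IH (fun s => g (b :: s))).
apply: eq_bigr => x _; case: (eqVneq x.2 [::]) => [->|x0].
  by rewrite /= !ev_lie1 /ev !big_nil cats1 addrC.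
rewrite ev_lie_rcons // evD evN.
have -> : ev (lie x.2) (fun u => f (x.1 ++ a :: u)) = ev (lie x.2) (fun v => f (rcons x.1 a ++ v)).
  by apply: eq_ev => u; rewrite cat_rcons.
rewrite [RHS]addrC subrK.
under [RHS]eq_ev => u do rewrite -rcons_cat.
by case: x.2 x0 => // b v _; rewrite addr0.
Qed.
End Newton.

(* [lcn N m], for [N >= m], lists the coefficients of Dynkin's operator omega_m on the
   elements Xi^r; the recursion is [newton] solved for its longest term, N being fuel. *)
Fixpoint lcn (N m : nat) : seq (int * seq nat) :=
  if N is N'.+1 then
    (m%:Z, [:: m]) ::
    flatten [seq [seq (- c.1, (m - k)%N :: c.2) | c <- lcn N' k] | k <- iota 1 m.-1]
  else [::].

(** The coefficients of omega_q on the Xi^r, obtained by multiplying the expansions for the single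
    parts. *)
Definition lcq (q : seq nat) : seq (int * seq nat) :=
  foldr (fun a L => [seq (c.1 * d.1, c.2 ++ d.2) | c <- lcn a a, d <- L]) [:: (1, [::])] q.

Section Expansion.
Variables (T : eqType) (V : zmodType).
Implicit Types (w : seq T).

Lemma big_unsh1 w (f : seq (seq T) -> V) :
  \sum_(us <- unsh [:: size w] w) f us = f [:: w].
Proof.
elim: w f => [|a w IH] f; first by rewrite /= big_seq1.
rewrite big_unsh_cons /= big_cat !big_map /= [X in _ + X]big1_seq ?addr0; last first.
  move=> x /andP[/eqP xw /splits_size xs]; exfalso; move: xs; rewrite xw; lia.
under eq_bigl => x do rewrite eqSS.
by rewrite -(IH (fun us => f [:: a :: head [::] us])) big_unsh_cons; apply: eq_bigr => x _;
  rewrite !big_unsh0; case: x.2.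
Qed.

Lemma ev_lcn N m w (f : seq T -> V) : (m <= N)%N -> (0 < m)%N -> size w = m ->
  ev (lie w) f = \sum_(c <- lcn N m) (\sum_(us <- unsh c.2 w) f (flatten us)) *~ c.1.
Proof.
elim: N m w f => [|N IH] m w f mN m0 szw; first by lia.
pose E x := ev (lie x.2) (fun v => f (x.1 ++ v)).
have -> : ev (lie w) f = f w *+ m - \sum_(x <- splits w | size x.1 != 0%N) E x.
  rewrite -{1}szw newton (bigID (fun x => size x.1 == 0%N)) /= addrK.
  by rewrite (big_splits_size0 w (fun s t => E (s, t))).
have unsh1 : \sum_(us <- unsh [:: m] w) f (flatten us) = f w by rewrite -szw big_unsh1 /= cats0.
rewrite [lcn _ _]/= big_cons [X in X *~ _ + _]unsh1 big_flatten big_map; congr (_ + _).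
(* The splittings are sorted by the length [k] of the bracketed half. For [k = 0] the bracket
   vanishes, and [k = m] is the term just isolated. *)
transitivity (- \sum_(k <- iota 1 m.-1) \sum_(x <- splits w | size x.1 == (m - k)%N) E x).
  congr (- _); rewrite big_mkcond [RHS](exchange_big_dep xpredT) //=; apply: eq_big_seq => -[x1 x2] /splits_size /= xw.
  have [x20|x20] := eqVneq x2 [::].
    by rewrite /E /= x20 /ev !big_nil; rewrite big1 //; case: ifP.
  have sz20 : (0 < size x2)%N by case: (x2) x20.
  have [x10|x10] := eqVneq (size x1) 0%N.
    rewrite big_seq_cond big1 // => k; rewrite mem_iota => /andP[k1 /eqP k2]; move: k2; rewrite x10; lia.
  have e2 : size x1 = (m - size x2)%N by lia.
  rewrite [RHS]big_mkcond (bigD1_seq (size x2)) ?mem_iota ?iota_uniq //=; last by lia.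
  rewrite {1}e2 eqxx big1_seq ?addr0 // => k /andP[kx]; rewrite mem_iota => k1.
  by rewrite ifF //; apply/negbTE; lia.
rewrite -sumrN; apply: eq_big_seq => k; rewrite mem_iota => km.
rewrite big_map -sumrN /=.
transitivity (\sum_(x <- splits w | size x.1 == (m - k)%N) \sum_(c <- lcn N k)
   (\sum_(us <- unsh c.2 x.2) f (x.1 ++ flatten us)) *~ - c.1).
  rewrite big_seq_cond [RHS]big_seq_cond; apply: eq_bigr => -[x1 x2] /andP[/splits_size /= xw /eqP xm].
  rewrite /E (IH k) /=; try lia.
  by rewrite -sumrN; apply: eq_bigr => c _; rewrite mulrNz.
rewrite exchange_big; apply: eq_bigr => c _.
by rewrite big_unsh_cons mulrz_suml; apply: eq_bigr.
Qed.

(** Only the leading term has a single part. The coefficient sum is m - (m - 1) = 1 by induction; it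
    becomes the coefficient of the identity permutation in omega_q. *)
Lemma lcn_struct N m : (m <= N)%N -> (0 < m)%N ->
  [/\ lcn N m = (m%:Z, [:: m]) :: behead (lcn N m),
      all (fun c => all (leq 1) c.2 && (sumn c.2 == m)) (lcn N m),
      all (fun c => 1 < size c.2)%N (behead (lcn N m))
    & \sum_(c <- lcn N m) c.1 = 1].
Proof.
elim: N m => [|N IH] m mN m0; first by lia.
have h k : k \in iota 1 m.-1 -> [/\ (0 < k)%N, (k <= N)%N & (k < m)%N] by rewrite mem_iota => ?; split; lia.
split => //=.
- rewrite addn0 eqxx m0 /=; apply/allP => c /flatten_mapP[k /h[k0 kN km] /mapP[d dk ->]] /=.
  have [_ /allP/(_ _ dk)/andP[-> /eqP ->] _ _] := IH k kN k0.
  by apply/andP; split; lia.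
- apply/allP => c /flatten_mapP[k /h[k0 kN km] /mapP[d dk ->]] /=.
  have [_ /allP/(_ _ dk)/andP[_ /eqP dE] _ _] := IH k kN k0.
  by case: d.2 dE => [|b s] //= dE; rewrite -dE in k0.
rewrite big_cons big_flatten big_map /= (eq_big_seq (fun=> - 1)) => [|k /h[k0 kN km]].
  by rewrite big_const_seq count_predT size_iota iter_addr_0; lia.
by rewrite big_map sumrN; have [_ _ _ ->] := IH k kN k0.
Qed.

Lemma lcq_struct q : all (leq 1) q ->
  [/\ lcq q = ((\prod_(i <- q) i)%N%:Z, q) :: behead (lcq q),
      all (fun c => all (leq 1) c.2 && (sumn c.2 == sumn q)) (lcq q),
      all (fun c => size q < size c.2)%N (behead (lcq q))
    & \sum_(c <- lcq q) c.1 = 1].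
Proof.
elim: q => [|a q IH] /=; first by rewrite big_seq1 big_nil.
case/andP=> a0 /IH [qE qP qS q1] {IH}.
have [aE aP aS a1] := lcn_struct (leqnn a) a0.
split.
- rewrite aE qE big_cons /= PoszM; congr cons.
- apply/allP => c /allpairsP[[x y] /= [xa yq ->]] /=.
  move/allP/(_ _ xa)/andP: aP => [x0 /eqP xs].
  move/allP/(_ _ yq)/andP: qP => [y0 /eqP ys].
  by rewrite all_cat x0 y0 sumn_cat xs ys /=.
- rewrite aE qE /= all_cat; apply/andP; split; apply/allP => c.
    case/mapP => y yq -> /=; rewrite ltnS.
    by move/allP/(_ _ yq): qS.
  case/flatten_mapP => x /(allP aS) x1.
  rewrite inE => /orP[/eqP -> /=|/mapP[y /(allP qS) yq ->] /=]; rewrite size_cat; lia.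
rewrite big_allpairs_dep /=.
under eq_bigr => c _ do rewrite -mulr_sumr q1 mulr1.
exact: a1.
Qed.

Lemma unsh_lcq q w (f : seq T -> V) : all (leq 1) q ->
  \sum_(us <- unsh q w) ev (lies us) f =
  \sum_(c <- lcq q) (\sum_(us <- unsh c.2 w) f (flatten us)) *~ c.1.
Proof.
elim: q w f => [|a q IH] w f.
  by rewrite big_seq1 !big_unsh0; case: w => //; rewrite ev_lies0.
case/andP=> a0 q0; rewrite big_unsh_cons /= big_allpairs_dep /=.
under eq_bigr => x _ do under eq_bigr => us _ do rewrite ev_lies_cons.
under eq_bigr => x _ do rewrite -ev_sum.
transitivity (\sum_(x <- splits w) \sum_(c <- lcn a a) \sum_(d <- lcq q)
   (\sum_(us <- unsh c.2 x.1) \sum_(vs <- unsh d.2 x.2) f (flatten (us ++ vs))) *~ (c.1 * d.1)).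
  (* When the left half does not have length [a], the right-hand side vanishes too, since each [c.2]
     has sum [a]. *)
  rewrite big_mkcond; apply: eq_bigr => x _; case: ifP => [/eqP xa|xa]; last first.
    rewrite big1_seq // => c /= ca; rewrite big1 // => d _.
    rewrite big1_seq ?mul0rz // => us /= /unsh_sumn.
    have [_ /allP/(_ _ ca)/andP[_ /eqP ->] _ _] := lcn_struct (leqnn a) a0.
    by move=> ax; rewrite ax eqxx in xa.
  rewrite (ev_lcn _ (leqnn a) a0 xa); apply: eq_bigr => c _.
  under eq_bigr => us _ do rewrite IH //.
  rewrite exchange_big mulrz_suml; apply: eq_bigr => d _.
  rewrite -mulrz_suml -mulrzA mulrC; congr (_ *~ _).
  apply: eq_bigr => us _; apply: eq_bigr => vs _; by rewrite flatten_cat.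
rewrite exchange_big; apply: eq_bigr => c _; rewrite exchange_big; apply: eq_bigr => d _.
by rewrite -mulrz_suml big_unsh_cat.
Qed.

End Expansion.

(** * Mackey formula *)

(** The candidates for the first row of a matrix with column sums [q], paired with the column sums
    left to the other rows. *)
Fixpoint subs (q : seq nat) : seq (seq nat * seq nat) :=
  if q is b :: q' then
    [seq (i :: x.1, (b - i)%N :: x.2) | i <- iota 0 b.+1, x <- subs q']
  else [:: ([::], [::])].

(* The weak compositions obtained by reading row by row the matrices of natural
   numbers with row sums r and column sums q. *)
Fixpoint mack (r q : seq nat) : seq (seq nat) :=
  if r is a :: r' then
    [seq x.1 ++ m | x <- [seq x <- subs q | sumn x.1 == a], m <- mack r' x.2]
  else if sumn q == 0%N then [:: [::]] else [::].

Section Mackey.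
Variables (T : eqType) (V : zmodType).
Implicit Types (w : seq T).

Lemma big_subs_cons b q (f : seq nat -> seq nat -> V) :
  \sum_(x <- subs (b :: q)) f x.1 x.2 =
  \sum_(i <- iota 0 b.+1) \sum_(x <- subs q) f (i :: x.1) ((b - i)%N :: x.2).
Proof. by rewrite /subs -/subs big_allpairs_dep. Qed.

Lemma big_iota_add (b s t : nat) (v : V) :
  \sum_(i <- iota 0 b.+1) (if (s == i) && (t == (b - i)%N) then v else 0) =
  if (s + t == b)%N then v else 0.
Proof.
have [sb|sb] := leqP s b; last first.
  rewrite ifF; last by apply/negbTE; lia.
  rewrite big1_seq // => i; rewrite mem_iota /= => ib.
  by rewrite ifF //; apply/negbTE; lia.
rewrite (bigD1_seq s) ?mem_iota ?iota_uniq //= eqxx /= big1_seq ?addr0; last first.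
  by move=> i /andP[si _]; rewrite eq_sym (negPf si).
by congr (if _ then _ else _); apply/eqP/eqP; lia.
Qed.

(** The coproduct is multiplicative: splitting a concatenation of blocks amounts to splitting every
    block, and [a] records the lengths of the left and right pieces. *)
Lemma unsh_splits q w (f : seq T -> seq T -> V) :
  \sum_(us <- unsh q w) \sum_(x <- splits (flatten us)) f x.1 x.2 =
  \sum_(a <- subs q) \sum_(x <- splits w) \sum_(us <- unsh a.1 x.1)
    \sum_(vs <- unsh a.2 x.2) f (flatten us) (flatten vs).
Proof.
elim: q w f => [|b q IH] w f.
  rewrite big_unsh0 [RHS]big_seq1; case: w => [|c w]; first by rewrite /= !big_seq1.
  symmetry; apply: (etrans (big_splits_cons c w (fun s t => \sum_(us <- unsh [::] s)
    \sum_(vs <- unsh [::] t) f (flatten us) (flatten vs)))).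
  by rewrite !big1 ?addr0 // => x _; [rewrite big1 // => us _; rewrite big_nil|rewrite big_nil].
rewrite big_unsh_cons (big_subs_cons b q (fun s t => \sum_(x <- splits w) \sum_(us <- unsh s x.1)
    \sum_(vs <- unsh t x.2) f (flatten us) (flatten vs))).
pose G y1 y2 z1 z2 := \sum_(a <- subs q) \sum_(us <- unsh a.1 z1) \sum_(vs <- unsh a.2 z2)
  f (y1 ++ flatten us) (y2 ++ flatten vs).
transitivity (\sum_(x <- splits w) \sum_(y <- splits x.1) \sum_(z <- splits x.2)
   if (size y.1 + size y.2 == b)%N then G y.1 y.2 z.1 z.2 else 0).
  rewrite big_mkcond; apply: eq_bigr => x _.
  transitivity (if size x.1 == b then \sum_(y <- splits x.1) \sum_(z <- splits x.2)
     G y.1 y.2 z.1 z.2 else 0).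
    case: ifP => // _; under eq_bigr => us _ do rewrite /= big_splits_cat.
    rewrite exchange_big; apply: eq_bigr => y _.
    rewrite (IH x.2 (fun s t => f (y.1 ++ s) (y.2 ++ t))).
    by rewrite exchange_big.
  case: ifP => xb; last first.
    rewrite big1_seq // => y /= /splits_size ->; rewrite xb.
    by rewrite big1.
  by apply: eq_big_seq => y /splits_size ->; rewrite xb.
(* So far [x] separates the first block from the rest. After exchanging the middle pieces, [x]
   separates what goes left from what goes right. *)
rewrite (big_splits_exch4 w (fun y1 y2 z1 z2 =>
   if (size y1 + size y2 == b)%N then G y1 y2 z1 z2 else 0)).
under [RHS]eq_bigr => i _ do rewrite exchange_big /=.
rewrite [RHS]exchange_big; apply: eq_bigr => x _ /=.
transitivity (\sum_(i <- iota 0 b.+1) \sum_(y <- splits x.1) \sum_(z <- splits x.2)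
   if (size y.1 == i) && (size z.1 == (b - i)%N) then G y.1 z.1 y.2 z.2 else 0).
  rewrite [RHS]exchange_big; apply: eq_bigr => y _ /=.
  rewrite [RHS]exchange_big; apply: eq_bigr => z _ /=.
  by rewrite big_iota_add.
apply: eq_bigr => i _.
transitivity (\sum_(a <- subs q) \sum_(y <- splits x.1 | size y.1 == i)
  \sum_(us <- unsh a.1 y.2) \sum_(z <- splits x.2 | size z.1 == (b - i)%N)
    \sum_(vs <- unsh a.2 z.2) f (y.1 ++ flatten us) (z.1 ++ flatten vs)); last first.
  apply: eq_bigr => a _; rewrite big_unsh_cons; apply: eq_bigr => y _.
  by apply: eq_bigr => us _; rewrite big_unsh_cons.
rewrite [RHS]exchange_big /= [RHS]big_mkcond; apply: eq_bigr => y _; case: ifP => _ /=; last by rewrite big1.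
rewrite -big_mkcond /=.
under [RHS]eq_bigr => a _ do rewrite exchange_big /=.
by rewrite [RHS]exchange_big.
Qed.

Lemma big_unsh_zeros q w (f : seq T -> V) : sumn q = 0%N ->
  \sum_(us <- unsh q w) f (flatten us) = if w is [::] then f [::] else 0.
Proof.
elim: q w f => [|a q IH] w f /=; first by rewrite big_unsh0.
move/eqP; rewrite addn_eq0 => /andP[/eqP -> /eqP q0].
rewrite -/(unsh (0%N :: q) w) big_unsh_zero; exact: IH.
Qed.

Lemma unsh_filter q w (f : seq T -> V) :
  \sum_(us <- unsh [seq i <- q | 0 < i]%N w) f (flatten us) = \sum_(us <- unsh q w) f (flatten us).
Proof.
elim: q w f => [|[|a] q IH] w f //; first by rewrite big_unsh_zero /= IH.
rewrite [filter _ _]/= !big_unsh_cons; apply: eq_bigr => x _.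
exact: (IH x.2 (fun s => f (x.1 ++ s))).
Qed.

(** Induction on the rows: the first block of [r] takes a subword from each block of [us], and the
    lengths of these subwords form the first row of the matrix. *)
Lemma unsh_unsh r q w (f : seq T -> V) :
  \sum_(us <- unsh q w) \sum_(vs <- unsh r (flatten us)) f (flatten vs) =
  \sum_(m <- mack r q) \sum_(us <- unsh m w) f (flatten us).
Proof.
elim: r q w f => [|a r IH] q w f.
  under eq_bigr => us _ do rewrite big_unsh0.
  rewrite /=; case: ifP => [/eqP q0|q0].
    rewrite (big_unsh_zeros w (fun s => if s is [::] then f [::] else 0) q0) big_seq1.
    by rewrite big_unsh0; case: w.
  rewrite big_nil big1_seq // => us /= usq.
  move: (unsh_shape usq) => sq; case E: (flatten us) => //.
  by move: q0; rewrite -sq -size_flatten E.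
under eq_bigr => us _ do rewrite big_unsh_cons big_mkcond.
rewrite (unsh_splits q w (fun s t => if size s == a then
  \sum_(vs <- unsh r t) f (s ++ flatten vs) else 0)).
rewrite /= big_allpairs_dep /= big_filter [RHS]big_mkcond; apply: eq_bigr => b _.
transitivity (\sum_(x <- splits w) \sum_(us <- unsh b.1 x.1) if sumn b.1 == a then
   \sum_(m <- mack r b.2) \sum_(vs <- unsh m x.2) f (flatten us ++ flatten vs) else 0).
  apply: eq_bigr => x _; apply: eq_big_seq => us usb.
  rewrite size_flatten (unsh_shape usb).
  case: ifP => _; last by rewrite big1.
  exact: (IH b.2 x.2 (fun s => f (flatten us ++ s))).
case: ifP => ba; last by rewrite big1 // => x _; rewrite big1.
transitivity (\sum_(x <- splits w) \sum_(m <- mack r b.2) \sum_(us <- unsh b.1 x.1)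
  \sum_(vs <- unsh m x.2) f (flatten us ++ flatten vs)).
  by apply: eq_bigr => x _; rewrite exchange_big.
rewrite exchange_big; apply: eq_bigr => m _ /=.
rewrite big_unsh_cat; apply: eq_bigr => x _; apply: eq_bigr => us _; apply: eq_bigr => vs _.
by rewrite flatten_cat.
Qed.

End Mackey.

Lemma subs_sumn q x : x \in subs q -> (sumn x.1 + sumn x.2)%N = sumn q.
Proof.
elim: q x => [|b q IH] x; first by rewrite inE => /eqP ->.
case/allpairsP => -[i y] [ib /IH yq ->]; move: ib yq; rewrite mem_iota /= => ib yq.
by rewrite addnACA yq; lia.
Qed.

Lemma mack_sumn r q m : m \in mack r q -> sumn m = sumn q.
Proof.
elim: r q m => [|a r IH] q m /=; first by case: eqP => // ->; rewrite inE => /eqP ->.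
case/allpairsPdep => x [y [xa /IH ym ->]].
move: xa; rewrite mem_filter => /andP[_ /subs_sumn <-].
by rewrite sumn_cat ym.
Qed.

(** * Unshuffles of a sorted word, and descent sets *)

Section SortedSplits.
Variables (T : eqType) (lt : rel T).
Hypotheses (lt_trans : transitive lt) (lt_irr : irreflexive lt).
Implicit Types (w u v : seq T).

Lemma splits_filter p w : ([seq x <- w | p x], [seq x <- w | ~~ p x]) \in splits w.
Proof.
elim: w => [|a w IH] //=; rewrite mem_cat; case: (p a) => /=; apply/orP; [left|right];
  by apply/mapP; exists ([seq x <- w | p x], [seq x <- w | ~~ p x]).
Qed.

Lemma splits_subseq w (x : seq T * seq T) : x \in splits w -> subseq x.1 w /\ subseq x.2 w.
Proof.
elim: w x => [|a w IH] x; first by rewrite inE => /eqP ->.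
rewrite mem_cat => /orP[] /mapP[y /IH[y1 y2] ->]; split.
- by rewrite /= eqxx.
- exact: subseq_trans y2 (subseq_cons _ _).
- exact: subseq_trans y1 (subseq_cons _ _).
- by rewrite /= eqxx.
Qed.

Lemma splits_uniqE w (x : seq T * seq T) : uniq w -> x \in splits w ->
  x.2 = [seq y <- w | y \notin x.1].
Proof.
elim: w x => [|a w IH] x; first by rewrite inE => _ /eqP ->.
case/andP=> aw uw; rewrite mem_cat => /orP[] /mapP[y yw ->] /=.
  rewrite inE eqxx /= (IH y uw yw); apply: eq_in_filter => z zw.
  by rewrite inE; case: eqP => // za; rewrite -za zw in aw.
have [/mem_subseq y1 _] := splits_subseq yw.
rewrite ifT; last by apply: contra aw => /y1.
by rewrite (IH y uw yw).
Qed.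

Lemma splits_uniq w : uniq w -> uniq (splits w).
Proof.
elim: w => [|a w IH] //= /andP[aw uw].
have inj1 : injective (fun x : seq T * seq T => (a :: x.1, x.2)) by move=> [? ?] [? ?] [-> ->].
have inj2 : injective (fun x : seq T * seq T => (x.1, a :: x.2)) by move=> [? ?] [? ?] [-> ->].
rewrite cat_uniq !map_inj_uniq // IH // andbT /=.
apply/hasPn => x /mapP[y yw ->]; apply/negP => /mapP[z zw [e _]].
have [/mem_subseq/(_ a) y1 _] := splits_subseq yw.
by move: aw; rewrite y1 // e inE eqxx.
Qed.

Fixpoint blk (q : seq nat) w : bool :=
  if q is a :: q' then sorted lt (take a w) && blk q' (drop a w) else w == [::].

Lemma mem_unsh q w0 w : sorted lt w0 ->
  (w \in [seq flatten us | us <- unsh q w0]) =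
  [&& perm_eq w w0, blk q w & sumn q == size w0].
Proof.
elim: q w0 w => [|a q IH] w0 w s0.
  case: w0 s0 => [|b w0] _ /=; last by rewrite !andbF.
  rewrite inE andbT; case: w => //= b w.
  by rewrite andbF.
apply/idP/idP.
  case/mapP => us /allpairsPdep[x [vs [xw vsq ->]]] -> /=.
  move: xw; rewrite mem_filter => /andP[/eqP xa xw].
  have [sx1 sx2] := splits_subseq xw.
  have := IH x.2 (flatten vs) (subseq_sorted lt_trans sx2 s0).
  rewrite map_f // => /esym/and3P[pv bv /eqP sq].
  rewrite -xa take_size_cat // drop_size_cat // bv (subseq_sorted lt_trans sx1 s0) sq.
  rewrite (splits_size xw) eqxx !andbT /=.
  by apply: perm_trans (splits_perm xw); rewrite perm_cat2l.
case/and3P => pw /= /andP[su bz] /eqP sq.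
have szw := perm_size pw.
have u0 := sorted_uniq lt_trans lt_irr s0.
set u := take a w in su; set z := drop a w in bz.
have szu : size u = a by rewrite size_takel // szw -sq leq_addr.
(* An increasing block is determined by its letters, hence is the subword of [w0] that they form. *)
have uE : u = [seq x <- w0 | x \in u].
  apply: (irr_sorted_eq lt_trans lt_irr) => //; first exact: sorted_filter.
  move=> x; rewrite mem_filter andb_idr // => /mem_take.
  by rewrite (perm_mem pw).
have xw : (u, [seq x <- w0 | x \notin u]) \in splits w0 by rewrite {1}uE splits_filter.
have [_ /= sv] := splits_subseq xw.
have zv : z \in [seq flatten us | us <- unsh q [seq x <- w0 | x \notin u]].
  rewrite IH ?bz /=; last exact: subseq_sorted sv s0.
  rewrite -(perm_cat2l u) cat_take_drop (perm_trans pw) 1?perm_sym ?(splits_perm xw) //=.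
  by have := splits_size xw; rewrite szu /= -sq => /addnI ->.
case/mapP: zv => vs vsq zE; apply/mapP; exists (u :: vs); last by rewrite /= -zE cat_take_drop.
apply/allpairsPdep; exists (u, [seq x <- w0 | x \notin u]); exists vs; split => //.
by rewrite mem_filter szu eqxx.
Qed.

(** Ensures that the sum over unshuffles has coefficients 0 and 1, as Xi^q does. *)
Lemma unsh_uniq q w0 : sorted lt w0 -> uniq [seq flatten us | us <- unsh q w0].
Proof.
elim: q w0 => [|a q IH] w0 s0; first by case: w0 s0.
rewrite /= map_allpairs /=.
have u0 := sorted_uniq lt_trans lt_irr s0.
have -> : [seq x.1 ++ flatten y | x <- [seq x <- splits w0 | size x.1 == a], y <- unsh q x.2] =
  [seq x.1 ++ y | x <- [seq x <- splits w0 | size x.1 == a], y <- [seq flatten us | us <- unsh q x.2]].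
  by rewrite allpairs_mapr.
apply: allpairs_uniq_dep; first by rewrite filter_uniq // splits_uniq.
  move=> x; rewrite mem_filter => /andP[_ xw]; apply: IH.
  by have [_ sx] := splits_subseq xw; apply: subseq_sorted sx s0.
move=> _ _ /allpairsPdep[x [y [xa yx ->]]] /allpairsPdep[x' [y' [xa' yx' ->]]] /= /eqP.
move: xa xa'; rewrite !mem_filter => /andP[/eqP xa xw] /andP[/eqP xa' xw'].
rewrite eqseq_cat ?xa ?xa' // => /andP[/eqP e1 /eqP ->].
suff -> : x = x' by [].
by rewrite [x]surjective_pairing [x']surjective_pairing (splits_uniqE u0 xw) (splits_uniqE u0 xw') e1.
Qed.

Lemma psums_cons a q : psums (a :: q) = a :: map (addn a) (psums q).
Proof.
rewrite /psums /= take0 /= addn0; congr cons.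
by rewrite -map_comp (iotaDl 1 1) -map_comp; apply: eq_map.
Qed.

(** Indices start at 0, so a comparison of entries [i] and [i.+1] concerns the 1-based descent
    position [i.+1]. The last partial sum is excluded by the bound on [i]. *)
Lemma blkP x0 q w : sumn q = size w ->
  reflect (forall i, (i.+1 < size w)%N -> i.+1 \notin psums q -> lt (nth x0 w i) (nth x0 w i.+1))
          (blk q w).
Proof.
elim: q w => [|a q IH] w /= sq.
  by case: w sq => // _; constructor.
have sqd : sumn q = size (drop a w) by rewrite size_drop -sq addKn.
have sza : size (take a w) = a by rewrite size_takel // -sq leq_addr.
apply: (iffP andP) => [[/(sortedP x0) h1 /(IH _ sqd) h2] i iw|h].
  rewrite psums_cons inE negb_or => /andP[ia ips].
  have [ia'|ia'] := ltnP i.+1 a.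
    by have := h1 i; rewrite sza => /(_ ia'); rewrite !nth_take //; lia.
  have [i' Ei] : exists i', i = (a + i')%N by exists (i - a)%N; lia.
  have := h2 i'; rewrite !nth_drop Ei addnS; apply.
    by rewrite size_drop; lia.
  by apply: contra ips => ips; apply/mapP; exists i'.+1; rewrite // Ei addnS.
split.
  apply/(sortedP x0) => i; rewrite sza => ia.
  have := h i; rewrite !nth_take ?(ltnW ia) //; apply; first by lia.
  rewrite psums_cons inE negb_or; apply/andP; split; first by lia.
  by apply/negP => /mapP[k _ E]; lia.
apply/IH => // i; rewrite size_drop => iw ips; rewrite !nth_drop addnS; apply: h; first by lia.
rewrite psums_cons inE negb_or; apply/andP; split; first by lia.
by rewrite -addnS mem_map //; apply: addnI.
Qed.

End SortedSplits.

(** * The group algebra *)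

Section GroupAlgebraTheory.
Variables (F : fieldType) (n : nat).
Local Notation GA := (GA F n).
Implicit Types (a b c x : GA) (s t : 'S_n).

Lemma gmul_linear_r a : linear (gmul a).
Proof.
move=> k b c; apply/ffunP => g; rewrite !ffunE scaler_sumr -big_split.
by apply: eq_bigr => h _; rewrite !ffunE mulrDr scalerAr.
Qed.
HB.instance Definition _ a := GRing.isLinear.Build F GA GA _ (gmul a) (gmul_linear_r a).

(** Right multiplication with the variable last, so that it can carry a linear structure. *)
Definition gmulr b a : GA := gmul a b.
Lemma gmul_linear_l b : linear (gmulr b).
Proof.
move=> k a c; apply/ffunP => g; rewrite !ffunE scaler_sumr -big_split.
by apply: eq_bigr => h _; rewrite !ffunE mulrDl scalerAl.
Qed.
HB.instance Definition _ b := GRing.isLinear.Build F GA GA _ (gmulr b) (gmul_linear_l b).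

Lemma gmulDr a b c : gmul a (b + c) = gmul a b + gmul a c. Proof. exact: linearD. Qed.
Lemma gmulBr a b c : gmul a (b - c) = gmul a b - gmul a c. Proof. exact: linearB. Qed.
Lemma gmulZr k a b : gmul a (k *: b) = k *: gmul a b. Proof. exact: linearZ. Qed.
Lemma gmul_sumr a (I : Type) (r : seq I) (P : pred I) (f : I -> GA) :
  gmul a (\sum_(i <- r | P i) f i) = \sum_(i <- r | P i) gmul a (f i).
Proof. exact: linear_sum. Qed.
Lemma gmulDl a b c : gmul (a + b) c = gmul a c + gmul b c. Proof. exact: (linearD (gmulr c)). Qed.
Lemma gmulBl a b c : gmul (a - b) c = gmul a c - gmul b c. Proof. exact: (linearB (gmulr c)). Qed.
Lemma gmul0l a : gmul 0 a = 0. Proof. exact: (linear0 (gmulr a)). Qed.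
Lemma gmulZl k a b : gmul (k *: a) b = k *: gmul a b. Proof. exact: (linearZZ (gmulr b)). Qed.
Lemma gmul_suml a (I : Type) (r : seq I) (P : pred I) (f : I -> GA) :
  gmul (\sum_(i <- r | P i) f i) a = \sum_(i <- r | P i) gmul (f i) a.
Proof. exact: (linear_sum (gmulr a)). Qed.

Lemma delta_decomp a : a = \sum_(g : 'S_n) a g *: delta F g.
Proof.
apply/ffunP => h; rewrite sum_ffunE (bigD1 h) //= !ffunE eqxx [_ *: _]mulr1 big1 ?addr0 // => g gh.
by rewrite !ffunE eq_sym (negPf gh) scaler0.
Qed.

Lemma gmul_delta s t : gmul (delta F s) (delta F t) = delta F (s * t)%g.
Proof.
apply/ffunP => g; rewrite !ffunE (bigD1 s) //= !ffunE eqxx mul1r big1 ?addr0 => [|h hs].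
  by congr (_%:R); rewrite -(inj_eq (mulgI s)) mulKVg.
by rewrite !ffunE (negPf hs) mul0r.
Qed.

Lemma gmulA a b c : gmul a (gmul b c) = gmul (gmul a b) c.
Proof.
rewrite [a]delta_decomp !gmul_suml; apply: eq_bigr => s _; rewrite !gmulZl; congr (_ *: _).
rewrite [b]delta_decomp gmul_suml !gmul_sumr gmul_suml; apply: eq_bigr => t _.
rewrite !(gmulZl, gmulZr); congr (_ *: _).
rewrite [c]delta_decomp !gmul_sumr; apply: eq_bigr => u _.
by rewrite !gmulZr !gmul_delta mulgA.
Qed.

Lemma gmul1l a : gmul (gone F n) a = a.
Proof.
rewrite [a in LHS]delta_decomp gmul_sumr [RHS]delta_decomp; apply: eq_bigr => s _.
by rewrite gmulZr gmul_delta mul1g.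
Qed.

Lemma gmul_ev a L (f : seq 'I_n -> GA) : gmul a (ev L f) = ev L (fun w => gmul a (f w)).
Proof. by rewrite /ev gmul_sumr; apply: eq_bigr => i _; rewrite -(raddfMz (gmul a)). Qed.

Definition wd s : seq 'I_n := [seq s i | i <- enum 'I_n].
(** Total on words: a word that lists no permutation is sent to 0. *)
Definition dw (w : seq 'I_n) : GA := \sum_(s | wd s == w) delta F s.

Lemma wd_inj : injective wd.
Proof. by move=> s t /eq_in_map st; apply/permP => i; apply: st; rewrite mem_enum. Qed.

Lemma dw_wd s : dw (wd s) = delta F s.
Proof. by rewrite /dw (eq_bigl (pred1 s)) ?big_pred1_eq // => t; rewrite (inj_eq wd_inj). Qed.

Lemma wdM s t : wd (s * t)%g = map t (wd s).
Proof. by rewrite /wd -map_comp; apply: eq_map => i; rewrite permM. Qed.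

Lemma wdP w : perm_eq w (enum 'I_n) -> exists s, w = wd s.
Proof.
move=> pw; have /tuple_permP[s ->] : perm_eq w (ord_tuple n) by rewrite val_ord_tuple.
by exists s; rewrite /= /wd; apply: eq_map => i; rewrite tnth_ord_tuple.
Qed.

Lemma dw_map t w : dw (map t w) = gmul (dw w) (delta F t).
Proof.
rewrite /dw gmul_suml (reindex_inj (mulIg t)) /=; apply: eq_big => s; last by rewrite gmul_delta.
by rewrite wdM (inj_eq (inj_map (@perm_inj _ t))).
Qed.

Definition XiW q w : GA := \sum_(us <- unsh q w) dw (flatten us).

(** Left multiplication permutes places and right multiplication renames letters. Unshuffling
    commutes with renaming, so the case of the identity word suffices. *)
Lemma gmul_XiW q w : perm_eq w (enum 'I_n) -> gmul (XiW q (enum 'I_n)) (dw w) = XiW q w.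
Proof.
case/wdP => s ->; rewrite dw_wd /wd /XiW (unsh_map s) [RHS]big_map gmul_suml.
by apply: eq_bigr => us _; rewrite -dw_map map_flatten.
Qed.

Lemma enum_ord_sorted : sorted (fun i j : 'I_n => i < j)%N (enum 'I_n).
Proof.
rewrite -[sorted _ _](@sorted_map _ _ val ltn) val_enum_ord; exact: iota_ltn_sorted.
Qed.

Lemma Xi_XiW q : sumn q = n -> Xi F n q = XiW q (enum 'I_n).
Proof.
move=> sq; have ltt : transitive (fun i j : 'I_n => i < j)%N by move=> ? ? ?; apply: ltn_trans.
have lti : irreflexive (fun i j : 'I_n => i < j)%N by move=> ?; rewrite ltnn.
rewrite /XiW -(big_map (@flatten _) xpredT dw) /dw.
rewrite (exchange_big_dep xpredT) //=.
rewrite /Xi big_mkcond; apply: eq_bigr => s _.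
have uL := unsh_uniq ltt lti q enum_ord_sorted.
(* By [unsh_uniq] the word of [s] occurs at most once, so the coefficient of [s] only tells whether
   it occurs. *)
transitivity (if wd s \in [seq flatten us | us <- unsh q (enum 'I_n)] then delta F s else 0); last first.
  case: ifP => sL.
    rewrite big_mkcond (bigD1_seq (wd s)) //= eqxx big1 ?addr0 // => w.
    by rewrite eq_sym => /negPf ->.
  by rewrite big1_seq // => w /andP[/eqP <-]; rewrite sL.
congr (if _ then _ else _); rewrite (mem_unsh ltt lti) ?enum_ord_sorted // size_enum_ord sq eqxx andbT.
have sz : size (wd s) = n by rewrite size_map size_enum_ord.
have -> : perm_eq (wd s) (enum 'I_n).
  apply: uniq_perm; rewrite ?enum_uniq ?(map_inj_uniq perm_inj) ?enum_uniq // => i.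
  by rewrite mem_enum -[i](permKV s) map_f ?mem_enum.
(* The default letter needed by [nth] exists only for positive [n]. *)
rewrite /=; have [n0|n0] := posnP n.
  have -> : wd s = [::] by apply/size0nil; rewrite sz.
  rewrite (_ : blk _ q _ = true); first by apply/forallP => -[j jn]; exfalso; rewrite n0 in jn.
  by elim: (q) => //= a r IH; rewrite IH.
pose x0 := Ordinal n0.
have nthw i (im : (i < n)%N) : nth x0 (wd s) i = s (Ordinal im).
  by rewrite (nth_map x0) ?size_enum_ord // (nth_ord_enum x0 (Ordinal im)).
have sqw : sumn q = size (wd s) by rewrite sz.
apply/idP/idP.
  move/forallP => h; apply/(blkP _ x0 sqw); rewrite sz.
  move=> i im iq; have im' := ltnW im.
  rewrite (nthw i im') (nthw i.+1 im).
  have := h (Ordinal im); apply: contraTT => sij; rewrite negb_imply iq andbT.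
  apply/existsP; exists (Ordinal im'); apply/existsP; exists (Ordinal im).
  rewrite /= !eqxx /= ltn_neqAle leqNgt sij andbT.
  by apply/negP => /eqP/val_inj/perm_inj/eqP; rewrite -val_eqE /= => /eqP; lia.
move/(blkP _ x0 sqw); rewrite sz => h; apply/forallP => j; apply/implyP => /existsP[j1 /existsP[j2 /and3P[/eqP e1 /eqP e2 sj]]].
apply: contraTT sj => jq; rewrite -leqNgt ltnW //.
have lj2 := ltn_ord j2; rewrite e2 -e1 in lj2.
have := h j1 lj2; rewrite e1 => /(_ jq).
rewrite (nthw j1 (ltn_ord j1)) (nthw j (ltn_ord j)).
have -> : Ordinal (ltn_ord j1) = j1 by apply: val_inj.
by have -> : Ordinal (ltn_ord j) = j2 by apply: val_inj; rewrite /= e2.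
Qed.

End GroupAlgebraTheory.

Definition descOK n (q : seq nat) (s : 'S_n) : bool :=
  [forall j : 'I_n, descent s j ==> (nat_of_ord j \in psums q)].

Lemma XiE (F : fieldType) n q (s : 'S_n) : Xi F n q s = (descOK q s)%:R.
Proof.
rewrite /Xi sum_ffunE; have [sq|sq] := boolP (descOK q s).
  rewrite (bigD1 s) //= ffunE eqxx big1 ?addr0 // => t /andP[_ ts].
  by rewrite ffunE eq_sym (negPf ts).
by rewrite big1 // => t tq; rewrite ffunE; case: eqP => // st; move: sq; rewrite st /descOK tq.
Qed.

(** * The action of omega_q on words, and the subring D_n *)

Section Omega.
Variables (F : fieldType) (n : nat).
Local Notation GA := (GA F n).
Local Notation dw := (dw F (n := n)).
Implicit Types (x y z : seq 'I_n) (t : 'S_n).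

Lemma size_wd t : size (wd t) = n. Proof. by rewrite size_map size_enum_ord. Qed.

Lemma nth_wd t (x0 i : 'I_n) : nth x0 (wd t) i = t i.
Proof. by rewrite (nth_map x0) ?size_enum_ord // nth_ord_enum. Qed.

Lemma wd_tp t x a b z : wd t = x ++ a :: b :: z ->
  wd (tp n (size x) (size x).+1 * t)%g = x ++ b :: a :: z.
Proof.
move=> wt; have sz := size_wd t; rewrite wt size_cat /= in sz.
have kn : (size x < n)%N by lia.
have kn1 : ((size x).+1 < n)%N by lia.
have -> : tp n (size x) (size x).+1 = tperm (Ordinal kn) (Ordinal kn1).
  by rewrite /tp (insubT (fun i => i < n)%N kn) (insubT (fun i => i < n)%N kn1).
apply: (@eq_from_nth _ a); first by rewrite size_wd size_cat /= sz.
move=> i; rewrite size_wd => im; rewrite -[i]/(val (Ordinal im)) nth_wd permM.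
rewrite -(nth_wd t a) wt !nth_cat /=.
case: tpermP => [/(congr1 val) /= ->|/(congr1 val) /= ->|n1 n2] /=.
- rewrite ltnn subnn ltnNge leqnSn /= subSn // subnn /=; reflexivity.
- by rewrite ltnn subnn ltnNge leqnSn /= subSn // subnn.
have {}n1 : i != size x by apply/eqP => e; apply: n1; apply: val_inj.
have {}n2 : i != (size x).+1 by apply/eqP => e; apply: n2; apply: val_inj.
case: ltnP => // xi.
have [k ->] : exists k, (i - size x = k.+2)%N by exists (i - size x - 2)%N; lia.
by [].
Qed.

(** The last transposition of the product acts first on the word: it moves [a] one place to the
    left, and induction carries [a] to the front. *)
Lemma wd_cyc t x y a z : wd t = x ++ rcons y a ++ z ->
  wd (cyc n (size x) (size y).+1 * t)%g = x ++ a :: y ++ z.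
Proof.
elim/last_ind: y t z => [|y b IH] t z wt; first by rewrite /cyc big_ord0 mul1g wt.
rewrite size_rcons /cyc big_ord_recr /= -mulgA.
have -> : (\prod_(j < size y) tp n (size x + j) (size x + j).+1)%g = cyc n (size x) (size y).+1 by [].
rewrite (IH _ (b :: z)) ?cat_rcons //.
rewrite catA -(size_cat x y); apply: wd_tp.
by rewrite wt !cat_rcons catA.
Qed.

Lemma gmul_cyc x y a z : perm_eq (x ++ rcons y a ++ z) (enum 'I_n) ->
  gmul (delta F (cyc n (size x) (size y).+1)) (dw (x ++ rcons y a ++ z)) = dw (x ++ a :: y ++ z).
Proof. by move/wdP => [t wt]; rewrite wt dw_wd gmul_delta -(wd_cyc (esym wt)) dw_wd. Qed.

Lemma omega_shS r j :
  omega_sh F n r j.+2 = gmul (gone F n - delta F (cyc n r j.+2)) (omega_sh F n r j.+1).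
Proof. by rewrite /omega_sh -[j.+2.-1]addn1 iotaD rev_cat /= add2n. Qed.

(** The factor 1 - c acts as u a - a u on a word already bracketed up to its last letter [a], which
    is the recursion of the left-normed bracket. *)
Lemma gmul_omega_sh x y z : y != [::] -> perm_eq (x ++ y ++ z) (enum 'I_n) ->
  gmul (omega_sh F n (size x) (size y)) (dw (x ++ y ++ z)) =
  ev (lie y) (fun y' => dw (x ++ y' ++ z)).
Proof.
elim/last_ind: y z => [|y a IH] // z _ pxyz.
have [->|y0] := eqVneq y [::]; first by rewrite ev_lie1 gmul1l.
rewrite ev_lie_rcons // size_rcons.
case E: (size y) => [|j]; first by rewrite (size0nil E) in y0.
rewrite omega_shS -gmulA -E cat_rcons (IH (a :: z)) //; last by rewrite -cat_rcons.
rewrite gmul_ev; apply: eq_ev_seq => c /lie_perm cy.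
rewrite gmulBl gmul1l -cat_rcons; congr (_ - _).
rewrite -(perm_size cy) gmul_cyc //.
apply: perm_trans pxyz; rewrite perm_cat2l perm_cat2r -!cats1 perm_cat2r //.
Qed.

(** Generalised over a prefix [x] occupying the parts [q1], because the shifts in [omega_up] are
    partial sums of the whole composition. *)
Lemma gmul_omega_up_aux q1 q2 x us : all (leq 1) q2 -> size x = sumn q1 -> shape us = q2 ->
  perm_eq (x ++ flatten us) (enum 'I_n) ->
  gmul (foldr (fun j acc => gmul (omega_sh F n (sumn (take j (q1 ++ q2)))
     (nth 0%N (q1 ++ q2) j)) acc) (gone F n) (iota (size q1) (size q2))) (dw (x ++ flatten us)) =
  ev (lies us) (fun y => dw (x ++ y)).
Proof.
elim: q2 q1 x us => [|a q2 IH] q1 x us.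
  by move=> _ _; case: us => // _ _; rewrite ev_lies0 gmul1l.
case/andP=> a0 q20 sx; case: us => // u us [su sus] pxu.
rewrite [iota _ _]/= [foldr _ _ _]/= take_size_cat // nth_cat ltnn subnn [nth _ _ _]/=.
rewrite -gmulA -cat_rcons -(size_rcons q1 a) catA IH //; first last.
- by rewrite -catA.
- by rewrite size_cat sx su sumn_rcons.
rewrite gmul_ev ev_lies_cons ev_exch; apply: eq_ev_seq => c /lies_perm cus.
rewrite -sx -su -catA gmul_omega_sh //; first by rewrite -size_eq0 su -lt0n.
by apply: perm_trans pxu; rewrite /= !perm_cat2l.
Qed.

Definition OmW q w : GA := \sum_(us <- unsh q w) ev (lies us) dw.

Lemma omega_q_OmW q : is_comp n q -> omega_q F n q = OmW q (enum 'I_n).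
Proof.
case/andP=> q0 /eqP sq; rewrite /omega_q (Xi_XiW F sq) /XiW gmul_sumr; apply: eq_big_seq => us usq.
have := @gmul_omega_up_aux [::] q [::] us q0 erefl (unsh_shape usq).
by rewrite /= => ->; last exact: unsh_perm usq.
Qed.

Lemma gmul_Xi_omega r q : is_comp n q -> is_comp n r ->
  gmul (Xi F n r) (omega_q F n q) =
  \sum_(us <- unsh q (enum 'I_n)) \sum_(g <- grp r us) ev (lies g) dw.
Proof.
move=> cq /andP[_ /eqP sr]; rewrite omega_q_OmW // (Xi_XiW F sr) /OmW gmul_sumr.
apply: eq_big_seq => us usq; rewrite gmul_ev -ev_lies_unsh; apply: eq_ev_seq => c cus.
by rewrite gmul_XiW // (perm_trans (lies_perm cus)) // (unsh_perm usq).
Qed.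

Lemma Xi_omega_long r q : is_comp n q -> is_comp n r -> (size q < size r)%N ->
  gmul (Xi F n r) (omega_q F n q) = 0.
Proof.
move=> cq cr qr; rewrite gmul_Xi_omega // big1_seq // => us /= /unsh_shape usq.
case/andP: cr => r0 _; rewrite grp_nil ?big_nil //.
by rewrite -(size_map size) -/(shape us) usq.
Qed.

Lemma Xi_omega_perm r q : is_comp n q -> is_comp n r -> perm_eq r q ->
  gmul (Xi F n r) (omega_q F n q) = (mfact r)%:R *: omega_q F n r.
Proof.
move=> cq cr rq; rewrite gmul_Xi_omega // (big_unsh_grp _ (fun g => ev (lies g) dw)) //.
  by rewrite scaler_nat omega_q_OmW.
by case/andP: cr.
Qed.

Lemma omega_expand q : is_comp n q ->
  omega_q F n q = \sum_(c <- lcq q) c.1%:~R *: Xi F n c.2.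
Proof.
move=> cq; rewrite omega_q_OmW //; case/andP: cq => q0 /eqP sq.
rewrite /OmW unsh_lcq //; apply: eq_big_seq => c cL.
have [_ /allP/(_ _ cL)/andP[_ /eqP sc] _ _] := lcq_struct q0.
by rewrite scaler_int (Xi_XiW F) // sc.
Qed.

Lemma zqE l : zq l = ((\prod_(i <- l) i) * mfact l)%N.
Proof.
rewrite /zq /mfact big_split /=; congr muln.
by rewrite big_undup_iterop_count; apply: eq_bigr => i _; rewrite /expn.
Qed.

(** In the expansion of the left factor, every term except the leading one has more parts than [q]
    and vanishes by [Xi_omega_long]. *)
Lemma omega_omega r q : is_comp n q -> is_comp n r -> perm_eq r q ->
  gmul (omega_q F n r) (omega_q F n q) = (zq r)%:R *: omega_q F n r.
Proof.
move=> cq cr rq; rewrite {1}omega_expand //.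
have /andP[r0 /eqP sr] := cr.
have [-> /allP rP rS _] := lcq_struct r0.
rewrite gmul_suml big_cons [X in _ + X]big1_seq ?addr0 => [|c /= cL].
  by rewrite gmulZl Xi_omega_perm // scalerA zqE natrM.
rewrite gmulZl Xi_omega_long ?scaler0 //.
  by have := rP c; rewrite inE cL orbT sr => /(_ isT).
by rewrite -(perm_size rq); apply: (allP rS).
Qed.

Lemma Xi_gone q : Xi F n q 1%g = 1.
Proof.
rewrite XiE (_ : descOK q _ = true) //; apply/forallP => j; apply/implyP.
case/existsP => j1 /existsP[j2 /and3P[/eqP e1 /eqP e2]].
by rewrite !perm1 -[nat_of_ord j2]/(val j2) e2 -e1 ltnNge leqnSn.
Qed.

(** Each Xi^r contains the identity once, and the coefficients in [lcq q] add up to 1. This yields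
    both the nonvanishing of omega_q and the trace of its matrix. *)
Lemma omega_gone q : is_comp n q -> omega_q F n q 1%g = 1.
Proof.
move=> cq; rewrite omega_expand // sum_ffunE.
under eq_bigr => c _ do rewrite ffunE Xi_gone [_ *: _]mulr1.
by case/andP: cq => /lcq_struct[_ _ _ h] _; rewrite -(rmorph_sum intr) h.
Qed.

Lemma omega_neq0 q : is_comp n q -> omega_q F n q != 0.
Proof.
by move=> cq; apply/eqP => /ffunP/(_ 1%g); rewrite omega_gone // ffunE; apply/eqP/oner_neq0.
Qed.

Lemma inD_scale k (x : GA) : inD x -> inD (k *: x).
Proof.
case=> cs [csP ->]; exists [seq (k * c.1, c.2) | c <- cs]; split.
  by rewrite all_map.
by rewrite big_map scaler_sumr; apply: eq_bigr => c _; rewrite scalerA.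
Qed.

Lemma inD_add (x y : GA) : inD x -> inD y -> inD (x + y).
Proof.
case=> cs [csP ->] [ds [dsP ->]]; exists (cs ++ ds).
by rewrite all_cat csP dsP big_cat.
Qed.

Lemma inD_sum (I : eqType) (r : seq I) (f : I -> GA) :
  (forall i, i \in r -> inD (f i)) -> inD (\sum_(i <- r) f i).
Proof.
elim: r => [|i r IH] h; first by rewrite big_nil; exists [::]; rewrite big_nil.
rewrite big_cons; apply: inD_add; first by apply: h; rewrite mem_head.
by apply: IH => j jr; apply: h; rewrite inE jr orbT.
Qed.

Lemma inD_Xi q : is_comp n q -> inD (Xi F n q).
Proof. by move=> cq; exists [:: (1, q)]; rewrite /= cq big_seq1 scale1r. Qed.

Lemma inD_omega q : is_comp n q -> inD (omega_q F n q).
Proof.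
move=> cq; rewrite omega_expand //; apply: inD_sum => c cL; apply/inD_scale/inD_Xi.
case/andP: cq => q0 /eqP <-.
by have [_ /allP/(_ _ cL)] := lcq_struct q0.
Qed.

Lemma inD_Xi_Xi r q : is_comp n r -> is_comp n q -> inD (gmul (Xi F n r) (Xi F n q)).
Proof.
case/andP=> _ /eqP sr /andP[_ /eqP sq]; rewrite (Xi_XiW F sq) (Xi_XiW F sr) {2}/XiW gmul_sumr.
rewrite (_ : \sum_(_ <- _) _ = \sum_(m <- mack r q) XiW F m (enum 'I_n)); last first.
  rewrite -unsh_unsh; apply: eq_big_seq => us /unsh_perm; exact: gmul_XiW.
apply: inD_sum => m /mack_sumn sm.
(* Zero parts yield empty blocks; dropping them turns a weak composition into a composition of
   [n]. *)
have sf : sumn [seq i <- m | 0 < i]%N = n.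
  by rewrite -sq -sm; elim: (m) => //= -[|a] s /= ->.
rewrite /XiW -unsh_filter -/(XiW F _ _) -Xi_XiW //; apply: inD_Xi.
by rewrite /is_comp sf eqxx filter_all.
Qed.

Lemma inD_mul (a b : GA) : inD a -> inD b -> inD (gmul a b).
Proof.
case=> cs [/allP csP ->] [ds [/allP dsP ->]]; rewrite gmul_suml; apply: inD_sum => c cL.
rewrite gmul_sumr; apply: inD_sum => d dL; rewrite gmulZl gmulZr; do 2 apply: inD_scale.
by apply: inD_Xi_Xi; [apply: csP | apply: dsP].
Qed.

End Omega.

(** * Ranks and dimensions *)

Section IntRank.
Variables (F : fieldType) (N : nat).

(** A nonzero minor of maximal size over [F] is the image of an integral minor, which is therefore
    nonzero over the rationals. *)
Lemma rank_int_rat (A : 'M[int]_N) :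
  (\rank (map_mx intr A : 'M[F]_N) <= \rank (map_mx intr A : 'M[rat]_N))%N.
Proof.
set AF := map_mx _ A; set AQ := map_mx _ A.
pose f := maxrankfun AF.
have rf : row_free (rowsub f AF) by apply: maxrowsub_free.
have cf : row_full (rowsub f AF)^T by rewrite /row_full mxrank_tr.
pose g := fullrankfun cf.
pose B := \matrix_(i, j) A (f j) (g i).
have BF : map_mx intr B = rowsub g (rowsub f AF)^T by apply/matrixP => i j; rewrite !mxE.
have BQ : map_mx intr B = rowsub g (rowsub f AQ)^T by apply/matrixP => i j; rewrite !mxE.
have uB : (map_mx intr B : 'M[F]__) \in unitmx.
  by rewrite BF fullrowsub_unit.
have dB : \det B != 0.
  move: uB; rewrite unitmxE unitfE det_map_mx; apply: contraNneq => ->; by rewrite rmorph0.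
have uQ : (map_mx intr B : 'M[rat]__) \in unitmx.
  by rewrite unitmxE unitfE det_map_mx intr_eq0.
rewrite -(mxrank_unit uQ) BQ.
apply: leq_trans (mxrankS (rowsub_sub _ _)) _.
by rewrite mxrank_tr mxrankS // rowsub_sub.
Qed.

End IntRank.

(** In a rank factorisation A = C R, cancelling C and R in the hypothesis gives R C = z; the trace
    of R C is that of A. *)
Lemma rank_quasi_idem (F : fieldType) (N : nat) (A : 'M[F]_N) (z : F) : z != 0 ->
  A *m A = z *: A -> z *+ \rank A = \tr A.
Proof.
move=> z0 AA; set C := col_base A; set R := row_base A.
have AE : A = C *m R by rewrite mulmx_base.
have RC : R *m C = z%:M.
  apply: (row_full_inj (col_base_full A)); apply: (row_free_inj (row_base_free A)).
  rewrite -/C -/R mul_mx_scalar -scalemxAl -AE -AA.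
  transitivity (C *m R *m (C *m R)); first by rewrite !mulmxA.
  by rewrite -!AE.
have -> : \tr A = \tr (C *m R) by rewrite -AE.
by rewrite mxtrace_mulC RC mxtrace_scalar.
Qed.

Lemma rank_quasi_idem_int (F : fieldType) (N z : nat) (A : 'M[int]_N) : z%:R != 0 :> F ->
  (0 < z)%N -> A *m A = z%:R *: A ->
  (z * \rank (map_mx intr A : 'M[F]_N))%N%:Z = \tr A.
Proof.
move=> zF z0 AA; have zQ : z%:R != 0 :> rat by rewrite pnatr_eq0 -lt0n.
pose B := z%:R%:M - A.
have AB : A *m B = 0 by rewrite mulmxBr mul_mx_scalar AA subrr.
have ABQ : (map_mx intr A : 'M[rat]_N) *m map_mx intr B = 0 by rewrite -map_mxM AB map_mx0.
have sF : (map_mx intr A : 'M[F]_N) + map_mx intr B = z%:R%:M.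
  by rewrite -map_mxD addrC subrK map_scalar_mx rmorph_nat.
(* With r and s the ranks of [A] and [B]: N <= r_F + s_F <= r_Q + s_Q <= N, so all are equalities
   and r_F = r_Q. *)
have e1 := rank_int_rat F A; have e2 := rank_int_rat F B.
have e3 := mulmx0_rank_max ABQ.
have e4 := mxrank_add (map_mx intr A : 'M[F]_N) (map_mx intr B).
rewrite sF mxrank_unit in e4; last by rewrite unitmxE det_scalar unitfE expf_neq0.
have -> : \rank (map_mx intr A : 'M[F]_N) = \rank (map_mx intr A : 'M[rat]_N) by lia.
apply: (@intr_inj rat).
have AAQ : (map_mx intr A : 'M[rat]_N) *m map_mx intr A = z%:R *: map_mx intr A.
  by rewrite -map_mxM AA map_mxZ rmorph_nat.
have := rank_quasi_idem zQ AAQ; rewrite trace_map_mx => <-.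
by rewrite -pmulrn natrM mulr_natr.
Qed.

(** * Right ideals and the matrix of left multiplication *)

Section RightIdeals.
Variables (F : fieldType) (n : nat).
Local Notation GA := (GA F n).
Implicit Types (x u a : GA).

Lemma rideal_limg x : rideal x = limg (linfun (gmul x)).
Proof.
apply/eqP; rewrite eqEsubv; apply/andP; split.
  by apply/span_subvP => _ /mapP[g _ ->]; rewrite -[gmul x _]lfunE memv_img ?memvf.
apply/subvP => _ /memv_imgP[a _ ->]; rewrite lfunE /= {1}[a]delta_decomp gmul_sumr.
apply: memv_suml => g _; rewrite gmulZr memvZ // memv_span //.
by apply/mapP; exists g; rewrite ?mem_enum.
Qed.

Lemma ridealP x u : reflect (exists a, u = gmul x a) (u \in rideal x).
Proof.
rewrite rideal_limg; apply: (iffP memv_imgP) => [[a _ ->]|[a ->]].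
  by exists a; rewrite lfunE.
by exists a; rewrite ?memvf // lfunE.
Qed.

Lemma rideal_stable x : rstable (rideal x).
Proof. by move=> u a /ridealP[b ->]; apply/ridealP; exists (gmul b a); rewrite gmulA. Qed.

Lemma rideal_sub x y : (exists a, x = gmul y a) -> (rideal x <= rideal y)%VS.
Proof.
case=> a ->; apply/subvP => u /ridealP[b ->]; apply/ridealP; exists (gmul a b).
by rewrite gmulA.
Qed.

(** Row [i] holds the coordinates of [x] times the [i]-th permutation. The coefficient ring is
    arbitrary, so that an integral matrix can be reduced into a field. *)
Definition gmx (R : pzRingType) (x : {ffun 'S_n -> R}) : 'M[R]_#|{: 'S_n}| :=
  \matrix_(i, j) x (enum_val j * (enum_val i)^-1)%g.

Lemma gmul_deltaE x g h : gmul x (delta F g) h = x (h * g^-1)%g.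
Proof.
rewrite ffunE (bigD1 (h * g^-1)%g) //= big1 ?addr0 => [|k kg].
  by rewrite ffunE invMg invgK mulgKV eqxx mulr1.
rewrite ffunE (_ : (_ == g) = false) ?mulr0 //; apply/negbTE; apply: contra kg => /eqP <-.
by rewrite invMg invgK mulKVg.
Qed.

Definition gco (u : GA) : 'rV[F]_#|{: 'S_n}| := \row_j u (enum_val j).
Definition goc (r : 'rV[F]_#|{: 'S_n}|) : GA := [ffun g => r 0 (enum_rank g)].

Lemma gco_linear : linear gco.
Proof. by move=> k u v; apply/rowP => j; rewrite !mxE !ffunE. Qed.
HB.instance Definition _ := GRing.isLinear.Build F GA _ _ gco gco_linear.
Lemma goc_linear : linear goc.
Proof. by move=> k u v; apply/ffunP => j; rewrite !ffunE !mxE. Qed.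
HB.instance Definition _ := GRing.isLinear.Build F _ GA _ goc goc_linear.

Lemma gcoK : cancel gco goc.
Proof. by move=> u; apply/ffunP => g; rewrite ffunE mxE enum_rankK. Qed.

Lemma row_gmx x i : row i (gmx (x : {ffun 'S_n -> F})) = gco (gmul x (delta F (enum_val i))).
Proof. by apply/rowP => j; rewrite !mxE gmul_deltaE. Qed.

(** Two coordinate systems are compared: that of [v2r], in which [\dim] is computed, and the one
    indexed by permutations. Base change in either direction gives one inequality of ranks. *)
Lemma dim_rideal x : \dim (rideal x) = \rank (gmx (x : {ffun 'S_n -> F})).
Proof.
rewrite /rideal unlock /dimv mx2vsK; set X := in_tuple _.
apply/eqP; rewrite eqn_leq; apply/andP; split.
  have h := mxrankM_maxl (gmx (x : {ffun 'S_n -> F})) (lin1_mx (v2r \o goc)).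
  apply: leq_trans h.
  apply/mxrankS/row_subP => i; rewrite rowK.
  have : tnth X i \in X by apply: mem_tnth.
  case/mapP => g _ ->; apply: (eq_row_sub (enum_rank g)).
  by rewrite row_mul mul_rV_lin1 /= row_gmx gcoK enum_rankK.
apply: leq_trans (mxrankM_maxl (b2mx X) (lin1_mx (gco \o r2v))).
apply/mxrankS/row_subP => i; rewrite row_gmx.
have : gmul x (delta F (enum_val i)) \in X by apply/mapP; exists (enum_val i); rewrite ?mem_enum.
case/tnthP => k Xk; apply: (eq_row_sub k).
by rewrite row_mul mul_rV_lin1 /= rowK v2rK -Xk.
Qed.

End RightIdeals.

Section IntegralOmega.
Variable n : nat.

(** The integral form of omega_q, common to all fields because the coefficients in [lcq] are
    integers. *)
Definition omegaZ (q : seq nat) : {ffun 'S_n -> int} :=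
  [ffun s => \sum_(c <- lcq q) c.1 * (descOK c.2 s)%:R].

Lemma omegaZE (F : fieldType) q s : is_comp n q -> omega_q F n q s = (omegaZ q s)%:~R.
Proof.
move=> cq; rewrite omega_expand // sum_ffunE ffunE rmorph_sum; apply: eq_bigr => c _ /=.
by rewrite ffunE XiE rmorphM /= rmorph_nat.
Qed.

Lemma map_gmx_omega (F : fieldType) q : is_comp n q ->
  map_mx intr (gmx (omegaZ q)) = gmx (omega_q F n q : {ffun 'S_n -> F}).
Proof. by move=> cq; apply/matrixP => i j; rewrite !mxE omegaZE. Qed.

(** Matrices act on row vectors from the right, which reverses the product. *)
Lemma gmxM (F : fieldType) (x y : GA F n) :
  gmx (x : {ffun 'S_n -> F}) *m gmx (y : {ffun 'S_n -> F}) = gmx (gmul y x : {ffun 'S_n -> F}).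
Proof.
apply/matrixP => i j; rewrite !mxE ffunE.
pose h (k : 'I_#|{: 'S_n}|) : 'S_n := (enum_val j * (enum_val k)^-1)%g.
rewrite [RHS](reindex h) /=; last first.
  exists (fun g => enum_rank (g^-1 * enum_val j)%g) => [k _|g _]; rewrite /h.
    by rewrite invMg invgK mulgKV enum_valK.
  by rewrite enum_rankK invMg invgK mulKVg.
apply: eq_bigr => k _; rewrite !mxE mulrC /h invMg invgK.
by rewrite -!mulgA mulKg.
Qed.

Lemma dim_rideal_omega (F : fieldType) q : is_comp n q -> (zq q)%:R != 0 :> F ->
  (zq q * \dim (rideal (omega_q F n q)))%N = n`!.
Proof.
move=> cq zF; rewrite dim_rideal -map_gmx_omega //.
have z0 : (0 < zq q)%N by rewrite lt0n; apply: contraNneq zF => ->.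
apply/eqP; rewrite -eqz_nat rank_quasi_idem_int //; last first.
  (* The integral identity is read off from [omega_omega] over the rationals. *)
  have intr_mx_inj : injective (map_mx intr : 'M[int]_#|{: 'S_n}| -> 'M[rat]_#|{: 'S_n}|).
    move=> B C /matrixP BC; apply/matrixP => i j; apply: (@intr_inj rat).
    by have := BC i j; rewrite !mxE.
  apply: intr_mx_inj; rewrite map_mxM map_mxZ /= map_gmx_omega // gmxM omega_omega //.
  by apply/matrixP => i j; rewrite !mxE ffunE rmorph_nat.
(* Each of the n! diagonal entries is the coefficient of the identity, namely 1. *)
rewrite /mxtrace (eq_bigr (fun=> 1)) => [|i _].
  by rewrite sumr_const card_ord card_Sn natz.
rewrite mxE mulgV; apply: (@intr_inj rat); by rewrite -omegaZE // omega_gone.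
Qed.

End IntegralOmega.

(** * Cycle types *)

Section CycleListings.
Variable T : finType.
Implicit Types (t g : {perm T}) (c d : seq T) (ss : seq (seq T)).

(** A full cycle notation for [t], fixed points included, with a chosen order of the cycles and a
    chosen start of each. *)
Definition listing t ss : Prop :=
  [/\ uniq (flatten ss), forall x, x \in flatten ss, all (fcycle t) ss & [::] \notin ss].

Lemma porbit_fconnect t x y : (y \in porbit t x) = fconnect t x y.
Proof.
apply/porbitP/idP => [[i ->]|xy]; first by rewrite permX fconnect_iter.
by exists (findex t x y); rewrite permX iter_findex.
Qed.

Lemma fcycle_porbit t c x : fcycle t c -> x \in c -> porbit t x =i c.
Proof. by move=> tc xc y; rewrite porbit_fconnect (fconnect_cycle tc xc). Qed.

Lemma uniq_in_flatten ss c : uniq (flatten ss) -> c \in ss -> uniq c.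
Proof.
elim: ss => // d ss IH /=; rewrite cat_uniq inE => /and3P[ud _ us] /orP[/eqP -> //|].
exact: IH.
Qed.

Lemma card_porbit t ss c x : listing t ss -> c \in ss -> x \in c -> #|porbit t x| = size c.
Proof.
case=> us _ /allP tss _ css xc; rewrite (eq_card (fcycle_porbit (tss _ css) xc)).
by apply/card_uniqP; apply: uniq_in_flatten us css.
Qed.

Lemma listing_shape t ss : listing t ss ->
  perm_eq (shape ss) [seq #|X| | X : {set T} <- enum (porbits t)].
Proof.
move=> lss; have [us cs /allP tss nss] := lss.
have nE c : c \in ss -> exists2 x, x \in c & [set y in c] = porbit t x.
  move=> css; case: c css => [|x c] css; first by rewrite css in nss.
  exists x; first by rewrite mem_head.
  by apply/setP => y; rewrite inE (fcycle_porbit (tss _ css)) ?mem_head.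
have -> : shape ss = [seq #|X| | X : {set T} <- [seq [set y in c] | c <- ss]].
  rewrite -map_comp; apply/eq_in_map => c css /=.
  by rewrite cardsE; apply/esym/card_uniqP/(uniq_in_flatten us).
apply: perm_map; apply: uniq_perm; rewrite ?enum_uniq //.
  elim: ss us nss {lss cs tss nE} => [|c ss IH] //=.
  rewrite cat_uniq inE negb_or => /and3P[_ hc us] /andP[c0 nss].
  rewrite IH // andbT; apply/mapP => -[d dss cd].
  case: c c0 hc cd => // x c _ /hasP hc cd; apply: hc; exists x; last by rewrite inE eqxx.
  apply/flattenP; exists d => //.
  by have := mem_head x c; rewrite -[x \in _](in_set (mem (x :: c))) cd inE.
move=> X; rewrite mem_enum; apply/mapP/imsetP => [[c /nE[x _ cx] ->]|[x _ ->]].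
  by exists x.
have /flattenP[c css xc] := cs x; exists c => //.
by apply/setP => y; rewrite inE (fcycle_porbit (tss _ css)).
Qed.

Lemma listing_perm t ss ss' : listing t ss -> all (fcycle t) ss' -> [::] \notin ss' ->
  perm_eq (flatten ss') (flatten ss) -> listing t ss'.
Proof.
case=> us cs _ _ tss' nss' pss; split=> //; first by rewrite (perm_uniq pss).
by move=> x; rewrite (perm_mem pss).
Qed.

Lemma fcycle_orbit t x : fcycle t (fingraph.orbit t x).
Proof. by apply: cycle_orbit; apply: perm_inj. Qed.

(** One orbit list per cycle, in decreasing order of length, so that the shape is literally the
    cycle type. *)
Lemma exists_listing t : exists2 ss, listing t ss &
  shape ss = sort geq [seq #|X| | X : {set T} <- enum (porbits t)].
Proof.
rewrite sort_map; set Ps := sort _ _.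
have uP : uniq Ps by rewrite sort_uniq enum_uniq.
have PP X : (X \in Ps) = (X \in porbits t) by rewrite mem_sort mem_enum.
have [xs xsE] : exists xs, Ps = map (porbit t) xs.
  have: {subset Ps <= porbits t} by move=> X; rewrite PP.
  elim: Ps {uP PP} => [|X Ps IH] h; first by exists [::].
  have [|xs ->] := IH; first by move=> Y YP; apply: h; rewrite inE YP orbT.
  by have /imsetP[x _ ->] := h X (mem_head _ _); exists (x :: xs).
exists [seq fingraph.orbit t x | x <- xs]; last first.
  rewrite /shape xsE -!map_comp; apply: eq_map => x /=.
  rewrite size_orbit /fingraph.order; apply: eq_card => y.
  by rewrite porbit_fconnect.
split.
- rewrite xsE in uP; elim: xs uP {xsE} => [|x xs IH] //= /andP[xxs uxs].
  rewrite cat_uniq orbit_uniq IH // andbT /=; apply/hasPn => y /flatten_mapP[z zxs yz].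
  apply: contra xxs => yx; apply/mapP; exists z => //; apply/eqP.
  rewrite -fconnect_orbit -porbit_fconnect -eq_porbit_mem in yz.
  rewrite /= -fconnect_orbit -porbit_fconnect -eq_porbit_mem in yx.
  by rewrite -(eqP yx) (eqP yz).
- move=> x; have : porbit t x \in Ps by rewrite PP imset_f.
  rewrite xsE => /mapP[z zxs xz]; apply/flatten_mapP; exists z => //.
  by rewrite -fconnect_orbit -porbit_fconnect -xz porbit_id.
- by rewrite all_map; apply/allP => x _; apply: fcycle_orbit.
- by apply/mapP => -[x _] /eqP; rewrite eq_sym -size_eq0 size_orbit eqn0Ngt fingraph.order_gt0.
Qed.

Lemma exists_perm_map (s s' : seq T) : uniq s -> uniq s' -> size s = size s' ->
  (forall x, x \in s) -> exists g : {perm T}, map g s = s'.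
Proof.
move=> us us' sz cs; pose f x := nth x s' (index x s).
have fi : injective f.
  move=> x y; rewrite /f (set_nth_default x) -?sz ?index_mem // => /eqP.
  by rewrite nth_uniq -?sz ?index_mem // => /eqP; apply: index_inj.
exists (perm fi); case E: s => [|x0 s0].
  by apply/esym/size0nil; rewrite -sz E.
rewrite -E; apply: (@eq_from_nth _ x0); first by rewrite size_map.
move=> i; rewrite size_map => ilt; rewrite (nth_map x0) // permE /f index_uniq //.
by apply: set_nth_default; rewrite -sz.
Qed.

(** The classical conjugation of cycle notations: [g] matches the two listings letter by letter, and
    both permutations act as [next] on their cycles. *)
Lemma listing_conj t t' ss ss' : listing t ss -> listing t' ss' -> shape ss = shape ss' ->
  exists g, map (map g) ss = ss' /\ (t ^ g)%g = t'.
Proof.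
case=> us cs tss _ [us' cs' tss' _] sh.
have [|g gE] := exists_perm_map us us' _ cs; first by rewrite !size_flatten sh.
have gss : map (map g) ss = ss'.
  apply: eq_from_flatten_shape; first by rewrite -map_flatten.
  by rewrite -sh /shape -map_comp; apply: eq_map => c /=; rewrite size_map.
exists g; split=> //; apply/permP => y; rewrite -[y](permKV g) conjgE !permM permK.
set x := (g^-1)%g y; have /flattenP[c css xc] := cs x.
have uc := uniq_in_flatten us css.
have tc' : fcycle t' (map g c) by apply: (allP tss'); rewrite -gss map_f.
rewrite -(nextE (allP tss _ css) xc) -(nextE tc') ?map_f //.
by rewrite next_map //; apply: perm_inj.
Qed.

Lemma exists_perm_listing ss : uniq (flatten ss) -> (forall x, x \in flatten ss) ->
  [::] \notin ss -> exists t, listing t ss.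
Proof.
move=> us cs nss; pose blkof x := nth [::] ss (find (fun c => x \in c) ss).
pose f x := next (blkof x) x.
have bE c x : c \in ss -> x \in c -> blkof x = c.
  rewrite /blkof; elim: ss us {cs nss f blkof} => // d ss IH /=.
  rewrite cat_uniq => /and3P[_ hd us] css xc; case: ifP => xd /=.
    move: css; rewrite inE => /orP[/eqP -> //|css].
    by case/hasP: hd; exists x => //; apply/flattenP; exists c.
  move: css; rewrite inE => /orP[/eqP cd|css]; last exact: IH.
  by rewrite -cd xc in xd.
have fi : injective f.
  move=> x y; rewrite /f; have /flattenP[c css xc] := cs x; have /flattenP[d dss yd] := cs y.
  rewrite (bE c x) // (bE d y) // => xy.
  have cd : c = d.
    rewrite -(bE c (next c x)) ?mem_next // xy; apply: bE => //.
    by rewrite mem_next.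
  by apply: (can_inj (prev_next (uniq_in_flatten us css))); rewrite xy cd.
exists (perm fi); split=> //; apply/allP => c css.
have uc := uniq_in_flatten us css.
apply: cycle_from_next => // x xc; rewrite /= permE /f (bE c x) //.
Qed.

End CycleListings.

(** * The order of a centralizer *)

Section Centralizer.
Variable T : finType.
Implicit Types (t g h : {perm T}) (c d : seq T) (ss pre post : seq (seq T)).

Definition fixcent t (s : seq T) : {set {perm T}} :=
  [set g in 'C[t]%g | all (fun x => g x == x) s].

Lemma in_fixcent t s g : (g \in fixcent t s) = (g \in 'C[t]%g) && all (fun x => g x == x) s.
Proof. by rewrite in_set. Qed.

Lemma cent1_perm t g : (g \in 'C[t]%g) = [forall x, g (t x) == t (g x)].
Proof.
apply/cent1P/forallP => [tg x|tg]; first by rewrite -!permM tg.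
by apply/permP => x; rewrite !permM; apply/esym/eqP.
Qed.

Lemma cent1_iter t g i x : g \in 'C[t]%g -> g (iter i t x) = iter i t (g x).
Proof.
rewrite cent1_perm => /forallP tg; elim: i => //= i IH.
by rewrite (eqP (tg _)) IH.
Qed.

Lemma card_porbit_cent t g x : g \in 'C[t]%g -> #|porbit t (g x)| = #|porbit t x|.
Proof.
move=> tg; rewrite -(card_imset (mem (porbit t x)) (@perm_inj _ g)).
apply: eq_card => y; apply/idP/imsetP => [/porbitP[i ->]|[z /porbitP[i ->] ->]].
  exists ((t ^+ i)%g x); first by rewrite mem_porbit.
  by rewrite !permX cent1_iter.
by rewrite permX cent1_iter // -permX mem_porbit.
Qed.

Lemma fcycle_orbit_perm t c y : fcycle t c -> uniq c -> y \in c ->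
  perm_eq (fingraph.orbit t y) c.
Proof.
move=> tc uc yc; apply: uniq_perm; rewrite ?orbit_uniq // => z.
by rewrite -fconnect_orbit (fconnect_cycle tc yc).
Qed.

Lemma orbit_neq_nil t y : fingraph.orbit t y != [::].
Proof. by rewrite -size_eq0 size_orbit -lt0n fingraph.order_gt0. Qed.

(** Two listings of the same [t] that agree on [pre], one with [y] in the place of [x], are related
    by an element of the centralizer. *)
Lemma exists_fixcent t pre c post x y d : listing t (pre ++ (x :: c) :: post) ->
  d \in (x :: c) :: post -> y \in d -> size d = (size c).+1 ->
  exists2 h, h \in fixcent t (flatten pre) & h x = y.
Proof.
move=> lss dss yd sd; have [us cs /allP tss nss] := lss.
have din : d \in pre ++ (x :: c) :: post by rewrite mem_cat dss orbT.
have pd := fcycle_orbit_perm (tss _ din) (uniq_in_flatten us din) yd.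
(* The cycle [d], rewritten to start at [y]. *)
set o := fingraph.orbit t y in pd.
have so : size o = (size c).+1 by rewrite (perm_size pd).
have oE : o = y :: behead o by rewrite /o /fingraph.orbit -orderSpred.
suff [post' lss' sh] : exists2 post', listing t (pre ++ o :: post') &
    shape (pre ++ o :: post') = shape (pre ++ (x :: c) :: post).
  have [h [hss ht]] := listing_conj lss lss' (esym sh).
  move/eqP: hss; rewrite map_cat eqseq_cat ?size_map // => /andP[/eqP hpre /eqP].
  rewrite oE => -[hx _ _]; exists h => //.
  rewrite inE cent1_perm; apply/andP; split.
    by apply/forallP => z; rewrite -{2}ht conjgE !permM permK.
  have: map h (flatten pre) = flatten pre by rewrite map_flatten hpre.
  by rewrite -{2}[flatten pre]map_id => /eq_in_map hp; apply/allP => z /hp ->.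
have to : fcycle t o by apply: fcycle_orbit.
have npre : [::] \notin pre by move: nss; rewrite mem_cat negb_or => /andP[].
have npost : [::] \notin post by move: nss; rewrite mem_cat !inE !negb_or => /andP[_ /andP[]].
have o0 : [::] != o by rewrite eq_sym orbit_neq_nil.
have tx : fcycle t (x :: c) by apply: tss; rewrite mem_cat mem_head orbT.
have tpre : all (fcycle t) pre by apply/allP => e ep; apply: tss; rewrite mem_cat ep.
have tpost : all (fcycle t) post by apply/allP => e ep; apply: tss; rewrite mem_cat inE ep !orbT.
(* Either [d] is the cycle of [x], merely rotated, or it changes places with that cycle. Equal
   lengths keep the shape. *)
move: dss; rewrite inE => /orP[/eqP dxc|/path.splitPr].
  exists post; last by rewrite /shape !map_cat /= so.
  apply: (listing_perm lss).
  - by rewrite all_cat /= tpre to tpost.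
  - by rewrite mem_cat inE !negb_or npre o0.
  - by rewrite !flatten_cat perm_cat2l /= -cat_cons perm_cat2r -dxc.
case E: _ / => [p1 p2]; exists (p1 ++ (x :: c) :: p2).
  apply: (listing_perm lss).
  - move: tpost; rewrite E all_cat => /andP[t1 /andP[_ t2]].
    apply/allP => e; rewrite mem_cat inE mem_cat inE => /orP[/(allP tpre)//|/orP[/eqP ->//|]].
    by case/orP => [/(allP t1)//|/orP[/eqP ->//|/(allP t2)]].
  - move: npost; rewrite E !mem_cat !inE !mem_cat !inE !negb_or => /and3P[-> _ ->].
    by rewrite npre o0.
  - have fc e es : flatten (e :: es) = e ++ flatten es :> seq T by [].
    apply/seq.permP => a; rewrite E !(flatten_cat, fc, count_cat) (seq.permP pd a).
    move: (count a (x :: c)) => k.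
    by congr addn; rewrite addnCA [RHS]addnCA; congr addn; rewrite addnCA.
by rewrite /shape !map_cat /= !map_cat /= so sd.
Qed.

Lemma zq_cons a l : zq (a :: l) = (a * count_mem a (a :: l) * zq l)%N.
Proof. rewrite !zqE mfact_cons big_cons; lia. Qed.

(** Orbit counting along the listing: the image of the first point [x] of the next cycle can be any
    remaining point on a cycle of the same length, and once [x] is fixed so is its whole cycle. This
    is the recursion [zq_cons]. *)
Lemma card_fixcent t pre post : listing t (pre ++ post) ->
  #|fixcent t (flatten pre)| = zq (shape post).
Proof.
elim: post pre => [|c post IH] pre lss.
  rewrite (_ : fixcent _ _ = [set 1%g]) ?cards1; last first.
    apply/setP => g; rewrite in_fixcent in_set1; apply/andP/eqP => [[_ /allP gp]|->].
      apply/permP => x; rewrite perm1; apply/eqP/gp.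
      by have [_ cs _ _] := lss; have := cs x; rewrite cats0.
    by rewrite group1; split=> //; apply/allP => x _; rewrite perm1.
  by rewrite zqE /mfact !big_nil.
case: c lss => [|x c] lss.
  by have [_ _ _] := lss; rewrite mem_cat mem_head orbT.
have [us cs /allP tss nss] := lss.
have css : x :: c \in pre ++ (x :: c) :: post by rewrite mem_cat mem_head orbT.
have IHc : #|fixcent t (flatten (rcons pre (x :: c)))| = zq (shape post).
  by apply: IH; rewrite cat_rcons.
rewrite -cats1 flatten_cat /= cats0 in IHc.
have fixE : fixcent t (flatten pre ++ x :: c) = [set g in fixcent t (flatten pre) | g x == x].
  apply/setP => g; rewrite in_set !in_fixcent all_cat -!andbA; apply: andb_id2l => tg; apply: andb_id2l => _ /=.
  apply: andb_idr => /eqP gx; apply/allP => z zc.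
  have /porbitP[i ->] : z \in porbit t x.
    by rewrite (fcycle_porbit (tss _ css)) ?mem_head // inE zc orbT.
  by rewrite permX cent1_iter // gx.
rewrite fixE in IHc.
(* The possible images of [x]. *)
pose Y := [set y | (y \in flatten ((x :: c) :: post)) && (#|porbit t y| == (size c).+1)].
have cardY : #|Y| = ((size c).+1 * count_mem (size c).+1 (shape ((x :: c) :: post)))%N.
  have uY : uniq [seq y <- flatten ((x :: c) :: post) | #|porbit t y| == (size c).+1].
    by apply: filter_uniq; move: us; rewrite flatten_cat cat_uniq => /and3P[].
  rewrite cardsE (_ : #|_| = size [seq y <- flatten ((x :: c) :: post) | #|porbit t y| == (size c).+1]).
    rewrite size_filter count_flatten.
    have : forall e, e \in (x :: c) :: post -> {in e, forall y, #|porbit t y| = size e}.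
      by move=> e ep y; apply: (card_porbit lss); rewrite mem_cat ep orbT.
    elim: ((x :: c) :: post) => [|d ds IHd] h /=; first by rewrite muln0.
    rewrite mulnDr -IHd; last by move=> e ep; apply: h; rewrite inE ep orbT.
    congr addn; rewrite (@eq_in_count _ _ (fun=> size d == (size c).+1)); last first.
      by move=> y yd /=; rewrite (h d (mem_head _ _) y yd).
    by case: eqP => [e|_]; rewrite ?muln0 ?count_pred0 // muln1 -e; apply: count_predT.
  rewrite -(card_uniqP uY); apply: eq_card => y.
  by rewrite mem_filter andbC.
rewrite [shape _]/= zq_cons -cardY -IHc -sum1_card (partition_big (fun g : {perm T} => g x) (mem Y)) /=; last first.
  move=> g; rewrite in_fixcent => /andP[tg /allP gp]; rewrite inE card_porbit_cent //.
  rewrite (card_porbit lss css (mem_head _ _)) eqxx andbT.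
  have := cs (g x); rewrite flatten_cat mem_cat => /orP[gxp|//].
  have /eqP/perm_inj gx := gp _ gxp.
  move: us; rewrite flatten_cat cat_uniq => /and3P[_ /hasP[]].
  by exists x; [rewrite /= mem_head | rewrite /= -gx].
rewrite -sum_nat_const; apply: eq_bigr => y.
rewrite inE => /andP[/flattenP[d dss yd]].
have din : d \in pre ++ (x :: c) :: post by rewrite mem_cat dss orbT.
rewrite (card_porbit lss din yd) => /eqP sd.
have [h hC hx] := exists_fixcent lss dss yd sd.
(* Right translation by [h] maps the stabilizer of [x] onto the elements that send [x] to [y]. *)
rewrite -sum1_card (reindex_inj (mulIg h)) /=; apply: eq_bigl => g.
rewrite [RHS]in_set permM -hx (inj_eq perm_inj); congr (_ && _).
move: hC; rewrite !in_fixcent => /andP[hC /allP hp]; rewrite groupMr //; congr (_ && _).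
apply: eq_in_all => z zp; rewrite permM -{2}(eqP (hp z zp)) (inj_eq perm_inj) //.
Qed.

End Centralizer.

Lemma mfact_perm l l' : perm_eq l l' -> mfact l = mfact l'.
Proof.
move=> ll'; rewrite /mfact (perm_big (undup l')) /=; last exact: perm_undup (perm_mem ll').
by apply: eq_bigr => i _; rewrite (seq.permP ll').
Qed.

Lemma zq_perm l l' : perm_eq l l' -> zq l = zq l'.
Proof. by move=> ll'; rewrite !zqE (mfact_perm ll') (perm_big _ ll'). Qed.

Lemma prime_ndvd_prod (I : eqType) p (l : seq I) (f : I -> nat) : prime p ->
  {in l, forall i, ~~ (p %| f i)%N} -> ~~ (p %| \prod_(i <- l) f i)%N.
Proof.
move=> pp; elim: l => [|a l IH] h.
  by rewrite big_nil dvdn1; apply: contraTneq pp => ->.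
rewrite big_cons Euclid_dvdM // negb_or h ?mem_head //=.
by apply: IH => i il; apply: h; rewrite inE il orbT.
Qed.

Lemma prime_ndvd_fact p k : prime p -> (k < p)%N -> ~~ (p %| k`!)%N.
Proof.
move=> pp kp; rewrite fact_prod.
apply: prime_ndvd_prod => // i; rewrite mem_index_iota => /andP[i0 ik].
by rewrite gtnNdvd //; lia.
Qed.

(** * Conjugacy classes and p-equivalence *)

Section ConjugacyClasses.
Variable n : nat.
Implicit Types (s t g : 'S_n).

Lemma cycletype_listing t ss : listing t ss -> cycletype t = sort geq (shape ss).
Proof.
move=> lss; rewrite /cycletype; apply/perm_sortP; last by rewrite perm_sym; apply: listing_shape.
- by move=> a b; apply: leq_total.
- by move=> a b c ab bc; apply: leq_trans bc ab.
- by move=> a b /andP[ab ba]; apply/eqP; rewrite eqn_leq; apply/andP.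
Qed.

Lemma listingJ t ss g : listing t ss -> listing (t ^ g)%g (map (map g) ss).
Proof.
case=> us cs /allP tss nss; split.
- by rewrite -map_flatten map_inj_uniq //; apply: perm_inj.
- by move=> x; rewrite -map_flatten -[x](permKV g) map_f.
- apply/allP => _ /mapP[c css ->]; have uc := uniq_in_flatten us css.
  apply: cycle_from_next; first by rewrite map_inj_uniq //; apply: perm_inj.
  move=> _ /mapP[x xc ->]; rewrite /= next_map //; last exact: perm_inj.
  by rewrite (nextE (tss _ css) xc) conjgE !permM permK.
- by apply/mapP => -[[|a c] css] //; rewrite css in nss.
Qed.

Lemma cycletypeJ t g : cycletype (t ^ g)%g = cycletype t.
Proof.
have [ss lss _] := exists_listing t.
rewrite (cycletype_listing lss) (cycletype_listing (listingJ g lss)).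
by congr sort; rewrite /shape -map_comp; apply: eq_map => c /=; rewrite size_map.
Qed.

Lemma cycletype_conj s t : cycletype s = cycletype t -> t \in (s ^: [set: 'S_n])%g.
Proof.
have [ss lss ssE] := exists_listing s; have [tt ltt ttE] := exists_listing t.
move=> st; have [|g [_ <-]] := listing_conj lss ltt; first by rewrite ssE ttE.
by apply: imset_f; rewrite inE.
Qed.

Lemma card_cent t : #|'C[t]%g| = zq (cycletype t).
Proof.
have [ss lss _] := exists_listing t; rewrite (cycletype_listing lss).
rewrite -[zq (sort _ _)](zq_perm (l := shape ss)); last by rewrite perm_sym perm_sort.
rewrite -(card_fixcent (pre := [::]) lss); apply: eq_card => g.
by rewrite in_fixcent andbT.
Qed.

Lemma exists_cycletype l : is_part n l -> exists t, cycletype t = l.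
Proof.
case/andP=> /andP[l0 /eqP sl] sol.
have sh : shape (reshape l (enum 'I_n)) = l by rewrite reshapeKl // size_enum_ord sl.
have fl : flatten (reshape l (enum 'I_n)) = enum 'I_n.
  by rewrite reshapeKr // size_enum_ord sl.
have [||| t lt] := @exists_perm_listing _ (reshape l (enum 'I_n)).
- by rewrite fl enum_uniq.
- by move=> x; rewrite fl mem_enum.
- apply/negP => /(map_f size); rewrite -/(shape _) sh => /(allP l0); by rewrite ltnn.
exists t; rewrite (cycletype_listing lt) sh; apply: sorted_sort => //.
by move=> a b c ab bc; apply: leq_trans bc ab.
Qed.

Lemma card_cclass l : is_part n l -> (zq l * #|cclass n l|)%N = n`!.
Proof.
case/exists_cycletype => t tl.
have -> : cclass n l = (t ^: [set: 'S_n])%g.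
  apply/setP => s; rewrite inE; apply/eqP/idP => [sl|/imsetP[g _ ->]].
    by apply: cycletype_conj; rewrite sl.
  by rewrite cycletypeJ.
rewrite -tl -card_cent -index_cent1 setTI -card_Sn -cardsT.
exact: (Lagrange (subsetT _)).
Qed.

(** The power of [t] by the product of its cycle lengths is trivial, and that product is prime to
    [p]. *)
Lemma cycletype_order p t : prime p -> all (fun i => ~~ (p %| i))%N (cycletype t) ->
  (p^'.-elt t)%g.
Proof.
move=> pp /allP tp; have [ss lss ssE] := exists_listing t.
have [_ cs _ _] := lss.
apply: (@pnat_dvd _ (\prod_(i <- cycletype t) i)%N); last first.
  by rewrite p'natE //; apply: prime_ndvd_prod.
rewrite order_dvdn; apply/eqP/permP => x; rewrite perm1 permX.
have /flattenP[c css xc] := cs x.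
have : size c \in cycletype t by rewrite /cycletype -ssE map_f.
move/(perm_to_rem) => pr; rewrite (perm_big _ pr) big_cons /= mulnC iterM.
rewrite -(card_porbit lss css xc); elim: (\prod_(_ <- _) _)%N => //= k ->.
exact: iter_porbit.
Qed.

Lemma prime_ndvd_zq p l : prime p -> all (fun i => ~~ (p %| i))%N l ->
  all (fun i => count_mem i l < p)%N l -> ~~ (p %| zq l)%N.
Proof.
move=> pp /allP lp /allP lc; rewrite zqE Euclid_dvdM // negb_or; apply/andP; split.
  exact: prime_ndvd_prod.
apply: prime_ndvd_prod => // i; rewrite mem_undup => il.
by apply: prime_ndvd_fact => //; apply: lc.
Qed.

(** A permutation of type [l] is its own p'-part. If the p'-part of [s] has type [l], the p-part of
    [s] lies in its centralizer, whose order [zq l] is prime to [p]; so the p-part is trivial. *)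
Lemma cclass_pE p l : prime p -> all (fun i => ~~ (p %| i))%N l ->
  all (fun i => count_mem i l < p)%N l -> cclass_p n p l = cclass n l.
Proof.
move=> pp lp lc; apply/setP => s; rewrite !inE; apply/existsP/eqP => [[t]|sl]; last first.
  by exists s; rewrite sl eqxx class_refl.
case/andP=> /eqP tl; rewrite (constt_p_elt (cycletype_order (t := t) pp _)) ?tl // => /imsetP[g _ sg].
have sl : cycletype (s.`_p^')%g = l by rewrite sg cycletypeJ.
suff s1 : (s.`_p = 1)%g by rewrite -(consttC p s) s1 mul1g.
apply/eqP; rewrite -order_eq1; apply/eqP/(@pnat_1 p); first exact: p_elt_constt.
apply: (@pnat_dvd _ (zq l)); last by rewrite p'natE // prime_ndvd_zq.
rewrite -sl -card_cent; apply: order_dvdG; apply/cent1P.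
exact: (commuteX2 _ _ (commute_refl s)).
Qed.

End ConjugacyClasses.

(** * The main theorem *)

(** Cutting positive parts into pieces cannot lower their number, and keeps it only if every part
    stays in one piece. *)
Lemma comp_lt_size n r q : is_comp n q -> comp_lt r q -> (size q < size r)%N.
Proof.
case/andP=> q0 _ [[rs [szr rsq prs]] nrq]; rewrite (perm_size prs).
suff : (size q <= size (flatten rs))%N /\ (size (flatten rs) = size q -> flatten rs = q).
  case=> le eq; rewrite ltn_neqAle le andbT; apply: contra nrq => /eqP/esym/eq <-.
  exact: prs.
elim: q rs q0 szr rsq {prs nrq} => [|a q IH] [|s rs] //= /andP[a0 q0] [szr] rsq.
have [le eq] := IH rs q0 szr (fun j jq => rsq j.+1 jq).
have [s0 sa] := rsq 0%N isT; rewrite /= in s0 sa.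
have s1 : (0 < size s)%N by case: s s0 sa {rsq} => //= _ a00; rewrite -a00 in a0.
rewrite size_cat; split; first by lia.
move=> sz; rewrite eq; last by lia.
by case: s s0 sa s1 sz {rsq} => [|b [|c s]] //=; [rewrite addn0 => _ -> | lia].
Qed.

Section Main.
Variables (F : fieldType) (p n : nat) (q : seq nat) (e : seq nat -> GA F n).
Hypotheses (pF : p \in [pchar F]) (cq : is_comp n q).
Hypotheses (qp : all (fun i => ~~ (p %| i))%N q) (lpart : is_part_p n p (sort geq q)).
Hypothesis (eP : idem_family p e).
Let l := sort geq q.
Let E := e l.
Let wq := omega_q F n q.
Let wl := omega_q F n l.
Let z : F := (zq l)%:R.
Let m : F := (mfact l)%:R.

Let lq : perm_eq l q. Proof. by rewrite perm_sort. Qed.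
Let pp : prime p. Proof. exact: pcharf_prime pF. Qed.
Let cl : is_comp n l. Proof. by case/andP: lpart => /andP[]. Qed.
Let lp : all (fun i => ~~ (p %| i))%N l. Proof. by rewrite (perm_all _ lq). Qed.
Let lc : all (fun i => count_mem i l < p)%N l. Proof. by case/andP: lpart. Qed.

Let z0 : z != 0.
Proof. by rewrite -(dvdn_pcharf pF) prime_ndvd_zq. Qed.

Let m0 : m != 0.
Proof. by apply: contraNneq z0 => mz; rewrite /z zqE natrM -/m mz mulr0. Qed.

Let zqq : (zq q)%:R = z. Proof. by rewrite /z (zq_perm lq). Qed.
Let mqq : (mfact q)%:R = m. Proof. by rewrite /m (mfact_perm lq). Qed.
Let ql : perm_eq q l. Proof. by rewrite perm_sym. Qed.

(** The correction terms have more parts than [l] and kill [wl]; on the leading term the factor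
    [mfact l] cancels. *)
Lemma e_omega : gmul E wl = wl.
Proof.
have [_ [_ /(_ l lpart)[cs [csP eE]]]] := eP.
rewrite /E eE gmulDl gmulZl Xi_omega_perm // scalerA mulVf // scale1r gmul_suml.
rewrite big1_seq ?addr0 // => c /= /csP[cc clt].
by rewrite gmulZl Xi_omega_long ?scaler0 // (comp_lt_size cl clt).
Qed.

Lemma omega_e : gmul wl E = z *: E.
Proof.
have [[eD eI _ ePr _] _] := eP; have [_ prim] := ePr l lpart.
(* The product of the idempotent [z^-1 *: wl] with [E]. *)
pose a := z^-1 *: gmul wl E.
have EE : gmul E E = E by apply: eI.
have ww : gmul wl wl = z *: wl by apply: omega_omega.
have Ea : gmul E a = a by rewrite gmulZr gmulA e_omega.
have aE : gmul a E = a by rewrite gmulZl -gmulA EE.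
have aa : gmul a a = a.
  by rewrite {1}/a gmulZl -gmulA Ea gmulZr gmulA ww gmulZl (scalerK z0).
have aD : inD a by apply/inD_scale/inD_mul; [apply: inD_omega | apply: eD].
have bD : inD (E - a) by apply: inD_add; [apply: eD | rewrite -scaleN1r; apply: inD_scale].
(* Primitivity is applied to the orthogonal decomposition of [E] into [a] and [E - a]; [a = 0] is
   impossible because [a] fixes the nonzero [wl]. *)
have [||||a0|b0] := prim a (E - a) aD bD aa.
- by rewrite gmulBl !gmulBr EE Ea aE aa subrr subr0.
- by rewrite gmulBr aE aa subrr.
- by rewrite gmulBl Ea aa subrr.
- by rewrite addrC subrK.
- have wa : gmul a wl = wl by rewrite gmulZl -gmulA e_omega ww scalerK.
  by have := omega_neq0 F cl; rewrite -/wl -wa a0 gmul0l eqxx.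
by move/eqP: b0; rewrite subr_eq0 => /eqP b0; rewrite [in RHS]b0 scalerA mulfV // scale1r.
Qed.

Lemma rideal_e : rideal E = rideal wl.
Proof.
apply/eqP; rewrite eqEsubv !rideal_sub //; first by exists wl; rewrite e_omega.
by exists (z^-1 *: E); rewrite gmulZr omega_e scalerK.
Qed.

Lemma rideal_Xi_e : rideal (gmul (Xi F n q) E) = rideal wq.
Proof.
apply/eqP; rewrite eqEsubv !rideal_sub //.
  (* Both witnesses come from Xi^q wl = m wq, combined with E wl = wl here and with wl E = z E
     below. *)
  exists (m^-1 *: wl).
  by rewrite gmulZr -gmulA e_omega Xi_omega_perm // mqq scalerA mulVf // scale1r.
exists ((m / z) *: E); rewrite gmulZr.
have -> : gmul (Xi F n q) E = z^-1 *: gmul (Xi F n q) (gmul wl E).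
  by rewrite omega_e gmulZr scalerK.
by rewrite gmulA Xi_omega_perm // mqq gmulZl scalerA mulrC.
Qed.

Let wqq : gmul wq wq = z *: wq.
Proof. by rewrite omega_omega // zqq. Qed.

Lemma rideal_wqK u : u \in rideal wq -> gmul wq u = z *: u.
Proof. by case/ridealP => a ->; rewrite gmulA wqq gmulZl. Qed.

Lemma Lie_iso : rmod_iso (rideal wq) (rideal E).
Proof.
have lqw : gmul wl wq = z *: wl by apply: omega_omega.
have qlw : gmul wq wl = z *: wq by rewrite omega_omega // zqq.
exists (fun u => z^-1 *: gmul wl u); rewrite rideal_e; split.
- move=> u _; rewrite memvZ //; apply/ridealP; by exists u.
- move=> v /ridealP[a ->]; exists (gmul wq a); first by apply/ridealP; exists a.
  by rewrite gmulA lqw gmulZl scalerK.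
(* Left multiplication by [wq] recovers [u] up to the invertible scalar z^2. *)
- move=> u v uM vM /(congr1 (gmul wq)) /=.
  rewrite !gmulZr !(gmulA wq wl) qlw !gmulZl !(scalerK z0).
  by rewrite !rideal_wqK // => /(can_inj (scalerK z0)).
- by move=> k u v _ _; rewrite gmulDr gmulZr scalerDr !scalerA mulrC.
- by move=> u a _; rewrite gmulA gmulZl.
Qed.

Lemma rideal_projective : projective (rideal wq).
Proof.
split; first exact: rideal_stable.
(* A retract of the free module of rank one: the inclusion is split by the idempotent
   [z^-1 *: wq]. *)
exists 1%N, (fun w => z^-1 *: gmul wq (w ord0)), (fun u => [ffun=> u]); split; last first.
  by move=> u uM; rewrite ffunE rideal_wqK // scalerK.
split.
- by move=> w; rewrite memvZ //; apply/ridealP; exists (w ord0).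
- by move=> k w1 w2; rewrite !ffunE gmulDr gmulZr scalerDr !scalerA mulrC.
- by move=> w a; rewrite ffunE gmulA gmulZl.
- by move=> k u v _ _; apply/ffunP => i; rewrite !ffunE.
- by move=> u a _; apply/ffunP => i; rewrite !ffunE.
Qed.

Lemma rideal_summand : direct_summand (rideal wq) (rideal (Xi F n q)).
Proof.
have MN : (rideal wq <= rideal (Xi F n q))%VS.
  apply: rideal_sub; exists (m^-1 *: wq).
  by rewrite gmulZr Xi_omega_perm // mqq scalerA mulVf // scale1r.
(* The complement is the kernel of the projection [z^-1 *: wq] on Xi^q F S_n. *)
exists (rideal (Xi F n q) :&: lker (linfun (gmul wq)))%VS; split.
- move=> u a; rewrite !memv_cap !memv_ker !lfunE /= => /andP[uN /eqP u0].
  by rewrite rideal_stable //= gmulA u0 gmul0l.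
- apply/eqP; rewrite eqEsubv; apply/andP; split.
    by rewrite subv_add MN capvSl.
  apply/subvP => u uN; rewrite -[u](subrK (z^-1 *: gmul wq u)) addrC.
  have uM : z^-1 *: gmul wq u \in rideal wq by rewrite memvZ //; apply/ridealP; exists u.
  apply: memv_add => //; rewrite memv_cap memvB //=; last exact: (subvP MN).
  by rewrite memv_ker lfunE /= gmulBr gmulZr gmulA wqq gmulZl scalerK // subrr.
apply/eqP; rewrite -subv0; apply/subvP => u; rewrite !memv_cap memv_ker lfunE /= memv0.
by case/and3P=> /rideal_wqK -> _; rewrite scaler_eq0 (negPf z0).
Qed.

Lemma dim_Lie : \dim (rideal wq) = (n`! %/ zq l)%N.
Proof.
have zn : (zq q)%:R != 0 :> F by rewrite zqq.
rewrite -(dim_rideal_omega cq zn) (zq_perm lq) mulKn // lt0n.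
by apply: contraNneq zn => ->.
Qed.

Lemma card_cclass_div : #|cclass n l| = (n`! %/ zq l)%N.
Proof.
have lP : is_part n l by case/andP: lpart.
rewrite -(card_cclass lP) mulKn // lt0n.
by apply: contraNneq z0 => zl; rewrite /z zl.
Qed.

End Main.

Theorem mainTheorem19 (F : fieldType) (p n : nat) (q : seq nat)
  (e : seq nat -> GA F n) :
  (forall s : seq F, exists x : F, x \notin s) ->
  p \in [pchar F] ->
  is_comp n q ->
  all (fun i => ~~ (p %| i))%N q ->
  is_part_p n p (sort geq q) ->
  idem_family p e ->
  let l := sort geq q in
  let M := rideal (gmul (Xi F n q) (e l)) in
  [/\ rmod_iso M (Lie F n q),
      rmod_iso (Lie F n q) (rideal (e l)),
      projective M,
      direct_summand M (rideal (Xi F n q))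
    & [/\ \dim M = #|cclass_p n p l|,
          #|cclass_p n p l| = #|cclass n l|
        & #|cclass n l| = (n`! %/ zq l)%N]].
Proof.
move=> _ pF cq qp lpart eP l M.
(* The two right ideals coincide, so the first isomorphism is the identity. *)
have -> : M = Lie F n q := rideal_Xi_e pF cq qp lpart eP.
have lp : all (fun i => ~~ (p %| i))%N l by rewrite (perm_all _ (permEl (perm_sort _ _))).
have lc : all (fun i => count_mem i l < p)%N l by case/andP: lpart.
rewrite cclass_pE //; last exact: pcharf_prime pF.
rewrite (card_cclass_div pF qp lpart); split.
- by exists id; split=> // v vL; exists v.
- exact: Lie_iso pF cq qp lpart eP.
- exact: rideal_projective pF cq qp lpart.
- exact: rideal_summand pF cq qp lpart.
- by split=> //; exact: dim_Lie pF cq qp lpart.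
Qed.
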